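(* Let $f:\mathbb{R}^d\to\mathbb{R}$ be SPB with parameters $\mathrm{R}_1,\mathrm{R}_2,m$, and for $\sigma>0$ let $f_\sigma(x)=\mathbb{E}_{u\sim\mathcal{N}(0,I)}[f(x+\sigma u)]$ (which is differentiable). Then: (i) For every $\sigma>0$ and every $x\in\mathbb{R}^d$, \[\nabla f_\sigma(x)=\mathbb{E}_{u\sim\mathcal{N}(0,I)}\big[\nabla f(x+\sigma u)\cdot\mathbb{1}_{\mathfrak{D}_\sigma}(u)\big],\] where $\mathfrak{D}_\sigma=\{u\in\mathbb{R}^d: f\text{ is differentiable at }x+\sigma u\}$ and $\mathbb{1}_{\mathfrak{D}_\sigma}$ is its indicator function. (ii) For every $\delta>0$ and $\varepsilon>0$, \[\nabla f_\sigma(x)\in\partial_G^\delta f(x)+(1+\|x\|^m)\varepsilon\cdot\mathbb{B}\qquad\text{for all }\sigma\in(0,\bar\sigma]\text{ and all }x\in\mathbb{R}^d,\] where \[\bar\sigma=\min\Big\{\Big[\tfrac{\varepsilon}{2^{m+1}\mathrm{R}_1(m+d)^{m/2}}\Big]^{1/m},\,1,\,\tfrac{\delta}{H}\Big\}\] (with the first term of the minimum omitted, i.e. interpreted as $+\infty$, when $m=0$), $H=\big[-d\cdot W_{-1}\big(-\eta_1^{2/d}/(2\pi e)\big)\big]^{1/2}$, $\eta_1=\min\{\varepsilon\mathcal{P}^{-1},(2\pi)^{d/2}-0.5\}$ and $\mathcal{P}=4\mathrm{R}_2+2^{m+1}\mathrm{R}_1(m+d)^{m/2}$.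
   Context: $\mathcal{N}(0,I)$ is the $d$-dimensional standard Gaussian distribution; $\|\cdot\|$ the Euclidean norm; $\mathbb{B}$ the closed unit ball in $\mathbb{R}^d$. For a locally Lipschitz $f$, $\partial_C f(x)$ denotes the Clarke subdifferential, and for $\delta>0$ the Goldstein $\delta$-subdifferential is $\partial_G^\delta f(x)=\mathrm{conv}\big(\bigcup_{y\in\mathbb{B}(x,\delta)}\partial_C f(y)\big)$, where $\mathbb{B}(x,\delta)$ is the closed ball of radius $\delta$ centered at $x$. $f$ is SPB with parameters $\mathrm{R}_1\ge0$, $\mathrm{R}_2>0$, integer $m\ge0$ (with $\mathrm{R}_1=0$ iff $m=0$) if $f$ is locally Lipschitz and $\sup_{\zeta\in\partial_Cf(x)}\|\zeta\|\le\mathrm{R}_1\|x\|^m+\mathrm{R}_2$ for all $x$ (convention $0^0=1$). $W_{-1}$ is the negative real branch of the Lambert $W$ function (inverse of $t\mapsto te^t$ from $[-1/e,0)$ onto $(-\infty,-1]$). *)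

(* Defs.v *)
From HB Require Import structures.
From mathcomp Require Import all_boot all_order all_algebra.
From mathcomp Require Import all_classical all_reals all_analysis.
Set Implicit Arguments. Unset Strict Implicit. Unset Printing Implicit Defensive.
Import Order.TTheory GRing.Theory Num.Theory.
Import numFieldNormedType.Exports.
Local Open Scope classical_set_scope.
Local Open Scope ring_scope.

Section Defs.
Variables (R : realType) (d : nat).
Notation vec := 'rV[R]_d.

Definition inner (x y : vec) : R := \sum_(i < d) x 0 i * y 0 i.
Definition enorm (x : vec) : R := Num.sqrt (\sum_(i < d) x 0 i ^+ 2).

Definition grad (f : vec -> R) (x : vec) : vec :=
  \row_(i < d) ('d f x (delta_mx 0 i : vec)).

Definition locally_lipschitz (f : vec -> R) : Prop :=
  forall x : vec, exists r : R, 0 < r /\ exists L : R,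
    forall y z : vec, enorm (y - x) < r -> enorm (z - x) < r ->
      `|f y - f z| <= L * enorm (y - z).

(* Clarke subdifferential: zeta \in d_C f(x) iff <zeta, v> <= f°(x; v) for all v,
   where f°(x;v) = limsup_{y -> x, t \downarrow 0} (f (y + t v) - f y) / t.
   The inequality <zeta,v> <= limsup is written out literally. *)
Definition clarke (f : vec -> R) (x : vec) : set vec :=
  [set zeta | forall (v : vec) (eta delta : R), 0 < eta -> 0 < delta ->
     exists (y : vec) (t : R), enorm (y - x) < delta /\ 0 < t /\ t < delta /\
       inner zeta v - eta < (f (y + t *: v) - f y) / t].

Definition conv (A : set vec) : set vec :=
  [set z | exists (n : nat) (w : 'I_n -> R) (p : 'I_n -> vec),
     (forall i, 0 <= w i) /\ \sum_(i < n) w i = 1 /\ (forall i, A (p i)) /\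
     z = \sum_(i < n) w i *: p i].

Definition goldstein (f : vec -> R) (delta : R) (x : vec) : set vec :=
  conv [set zeta | exists y : vec, enorm (y - x) <= delta /\ clarke f y zeta].

(* SPB with parameters R1, R2, m (convention 0^0 = 1 holds for ^+) *)
Definition SPB (f : vec -> R) (R1 R2 : R) (m : nat) : Prop :=
  0 <= R1 /\ 0 < R2 /\ (R1 = 0 <-> m = 0%N) /\ locally_lipschitz f /\
  forall (x zeta : vec), clarke f x zeta -> enorm zeta <= R1 * enorm x ^+ m + R2.

(* R^d modelled measure-theoretically as d.-tuple R (product sigma-algebra) *)
Definition rv (t : d.-tuple R) : vec := \row_(i < d) tnth t i.

Definition std_gaussian (P : probability (d.-tuple R) R) : Prop :=
  forall A : 'I_d -> set R, (forall i, measurable (A i)) ->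
    P [set t | forall i, A i (tnth t i)] = (\prod_(i < d) normal_prob 0 1 (A i))%E.

Definition smoothing (P : probability (d.-tuple R) R) (f : vec -> R) (sigma : R)
  (x : vec) : R := Rintegral P setT (fun t => f (x + sigma *: rv t)).

Definition lambertWm1 (y : R) : R := xget 0 [set t : R | t <= -1 /\ t * expR t = y].

Definition Pconst (R1 R2 : R) (m : nat) : R :=
  4 * R2 + 2 ^+ m.+1 * R1 * ((m + d)%:R `^ (m%:R / 2)).
Definition eta1 (R1 R2 : R) (m : nat) (eps : R) : R :=
  Num.min (eps * (Pconst R1 R2 m)^-1) ((2 * pi) `^ (d%:R / 2) - 2^-1).
Definition Hconst (R1 R2 : R) (m : nat) (eps : R) : R :=
  Num.sqrt (- (d%:R * lambertWm1 (- ((eta1 R1 R2 m eps) `^ (2 / d%:R)) / (2 * pi * expR 1)))).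
Definition sigma_bar (R1 R2 : R) (m : nat) (eps delta : R) : R :=
  if m == 0%N then Num.min 1 (delta / Hconst R1 R2 m eps)
  else Num.min ((eps / (2 ^+ m.+1 * R1 * ((m + d)%:R `^ (m%:R / 2)))) `^ (m%:R^-1))
               (Num.min 1 (delta / Hconst R1 R2 m eps)).

End Defs.

(* Main.v *)
(* The Clarke bound makes f Lipschitz with polynomially growing constant: the
   Clarke directional derivative is sublinear and attained (Hahn-Banach), so it
   bounds the Dini derivatives of f along segments.

   Differentiability Gaussian-almost everywhere (Rademacher) is shown through the
   quotients (n+1) (f(u + v/(n+1)) - f(u)). They converge a.e. for each fixed v,
   by the one-dimensional theorem on the lines u + s v and quasi-invariance of the
   Gaussian measure under translations; the limit is additive in v, tested
   against orthants after a Cameron-Martin change of variables; and convergence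
   for the countably many integer vectors v to a linear function of v already
   forces differentiability. Part (i) follows by dominated convergence.

   For (ii), let S = {|u| <= H} and let g be a point of the convex hull of the
   gradients at x + sigma u, u in S, close to their mean over S; since
   sigma H <= delta, g lies in the Goldstein subdifferential. The remaining error
   is an integral over the complement of S of a polynomial in |u|, controlled by
   the Chernoff bound P(|u| > H) <= eta_1 / (2 pi)^(d/2), which is what the
   Lambert function in H encodes, and by E |u|^m <= (m + d)^(m/2). *)
Require Import Defs.
From HB Require Import structures.
From mathcomp Require Import all_boot all_order all_algebra.
From mathcomp Require Import ring lra.
From mathcomp Require Import all_classical all_reals all_analysis.
From mathcomp Require Import measurable_realfun.
Set Implicit Arguments. Unset Strict Implicit. Unset Printing Implicit Defensive.
Import Order.TTheory GRing.Theory Num.Theory.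
Import numFieldNormedType.Exports.
Local Open Scope classical_set_scope.
Local Open Scope ring_scope.

(** * Euclidean norm *)

Section euclidean_norm.
Variables (R : realType) (d : nat).
Implicit Types (x y z : 'rV[R]_d) (c : R).

(** Each ingredient of the almost everywhere argument answers an obstacle. Additivity of the limit
    in v only reaches integer combinations of basis vectors, so these are the test directions, and
    no homogeneity has to be proved. A translated indicator must converge almost everywhere: for an
    orthant this holds off finitely many coordinate hyperplanes, which are null, and orthants still
    generate the sigma-algebra. All dominating functions have the form b exp(a |u|), a class that
    absorbs polynomial growth, affine changes of variable and Cameron-Martin weights. [std_gaussian]
    is only a formula on boxes, so every Gaussian identity is a one-dimensional computation lifted
    by a product formula. In (ii) the convex hull is not closed, so the mean over S is only
    approximated by hull points. The room for this error comes from (2 pi)^(d/2) >= 2, which turns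
    the Chernoff bound q <= eta_1 / (2 pi)^(d/2) into 2 q <= eta_1. *)

Lemma enorm_ge0 x : 0 <= enorm x.
Proof. exact: sqrtr_ge0. Qed.

Lemma sqr_enorm x : enorm x ^+ 2 = \sum_(i < d) x 0 i ^+ 2.
Proof. by rewrite sqr_sqrtr// sumr_ge0// => i _; exact: sqr_ge0. Qed.

Lemma inner_self x : inner x x = enorm x ^+ 2.
Proof. by rewrite sqr_enorm; apply: eq_bigr => i _; rewrite expr2. Qed.

Lemma innerC x y : inner x y = inner y x.
Proof. by apply: eq_bigr => i _; rewrite mulrC. Qed.

Lemma innerDl x y z : inner (x + y) z = inner x z + inner y z.
Proof. by rewrite -big_split; apply: eq_bigr => i _; rewrite mxE mulrDl. Qed.

Lemma innerZl c x y : inner (c *: x) y = c * inner x y.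
Proof. by rewrite /inner mulr_sumr; apply: eq_bigr => i _; rewrite mxE mulrA. Qed.

Lemma innerDr x y z : inner x (y + z) = inner x y + inner x z.
Proof. by rewrite innerC innerDl !(innerC x). Qed.

Lemma innerZr c x y : inner x (c *: y) = c * inner x y.
Proof. by rewrite innerC innerZl innerC. Qed.

Lemma innerNr x y : inner x (- y) = - inner x y.
Proof. by rewrite -scaleN1r innerZr mulN1r. Qed.

Lemma inner_delta x (i : 'I_d) : inner x (delta_mx 0 i) = x 0 i.
Proof.
rewrite /inner (bigD1 i)//= mxE !eqxx mulr1 big1 ?addr0// => j ji.
by rewrite mxE eqxx (negPf ji) mulr0.
Qed.

Lemma enorm0 : enorm (0 : 'rV[R]_d) = 0.
Proof. by rewrite /enorm big1 ?sqrtr0// => i _; rewrite mxE expr0n. Qed.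

Lemma enormZ c x : enorm (c *: x) = `|c| * enorm x.
Proof.
rewrite /enorm -sqrtr_sqr -sqrtrM ?sqr_ge0// mulr_sumr.
by congr Num.sqrt; apply: eq_bigr => i _; rewrite mxE exprMn.
Qed.

Lemma enormN x : enorm (- x) = enorm x.
Proof. by rewrite -scaleN1r enormZ normrN1 mul1r. Qed.

Lemma ler_coord_enorm x (i : 'I_d) : `|x 0 i| <= enorm x.
Proof.
rewrite -sqrtr_sqr ler_wsqrtr// (bigD1 i)//= lerDl sumr_ge0// => j _.
exact: sqr_ge0.
Qed.

Lemma enorm_eq0 x : enorm x = 0 -> x = 0.
Proof.
move=> x0; apply/rowP => i; rewrite mxE; apply/normr0_eq0/le_anti.
by rewrite normr_ge0 -x0 ler_coord_enorm.
Qed.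

Lemma inner_le x y : inner x y <= enorm x * enorm y.
Proof.
have [a0|a0] := eqVneq (enorm x) 0.
  rewrite a0 (enorm_eq0 a0) /inner big1 ?mul0r// => i _.
  by rewrite mxE mul0r.
have [b0|b0] := eqVneq (enorm y) 0.
  rewrite b0 (enorm_eq0 b0) /inner big1 ?mulr0// => i _.
  by rewrite mxE mulr0.
(* With a = |x|, b = |y| and p = <x, y>, this square is 2 a b (a b - p), and the factor a b > 0 can
   be divided out. *)
have := sqr_ge0 (enorm (enorm y *: x - enorm x *: y)).
rewrite -inner_self innerDl !innerDr -scaleNr !innerZl !innerZr !inner_self.
rewrite (innerC y x).
set a := enorm x; set b := enorm y; set p := inner x y.
have ap : 0 < a by rewrite lt_neqAle eq_sym a0 enorm_ge0.
have bp : 0 < b by rewrite lt_neqAle eq_sym b0 enorm_ge0.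
move=> h; rewrite -subr_ge0 -(pmulr_rge0 _ (mulr_gt0 ap bp)).
have : 0 <= 2 * (a * b * (a * b - p)) by move: h; congr (0 <= _); rewrite /a /b /p; ring.
by move=> h2; lra.
Qed.

Lemma enormD x y : enorm (x + y) <= enorm x + enorm y.
Proof.
rewrite -(@ler_pXn2r _ 2)// ?nnegrE ?addr_ge0 ?enorm_ge0//.
rewrite -inner_self innerDl !innerDr !inner_self (innerC y x) sqrrD.
have := inner_le x y; lra.
Qed.

Lemma enormB x y : enorm (x - y) = enorm (y - x).
Proof. by rewrite -enormN opprB. Qed.

Lemma enorm_sum (I : finType) (F : I -> 'rV[R]_d) :
  enorm (\sum_i F i) <= \sum_i enorm (F i).
Proof.
elim/big_ind2: _ => [|x1 x2 y1 y2 h1 h2|//]; first by rewrite enorm0.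
by rewrite (le_trans (enormD _ _))// lerD.
Qed.

Lemma ler_coord_norm x (i : 'I_d) : `|x 0 i| <= `|x|.
Proof. by rewrite [`|x|]mx_normrE; exact: (le_bigmax _ (fun k => `|x k.1 k.2|) (0, i)). Qed.

Lemma ler_enorm_sum x : enorm x <= \sum_(i < d) `|x 0 i|.
Proof.
rewrite {1}(row_sum_delta x) (le_trans (enorm_sum _))// ler_sum// => i _.
rewrite enormZ ler_piMr// -[leRHS]sqrtr1 ler_wsqrtr// (bigD1 i)//= big1 => [|j ji].
  by rewrite mxE !eqxx expr1n addr0.
by rewrite mxE (negPf ji) andbF expr0n.
Qed.

(** The norm [|x|] of a row vector is the sup norm, which carries the topology and
    differentiability; this bound and [ler_coord_enorm] translate between it and the Euclidean
    norm. *)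
Lemma ler_enorm_norm x : enorm x <= d%:R * `|x|.
Proof.
rewrite (le_trans (ler_enorm_sum x))//.
have -> : d%:R * `|x| = \sum_(i < d) `|x|.
  by rewrite sumr_const card_ord mulr_natl.
apply: ler_sum => i _.
exact: ler_coord_norm.
Qed.

Lemma norm_inner_le x y : `|inner x y| <= enorm x * enorm y.
Proof.
rewrite ler_norml lerNl inner_le andbT.
by rewrite -innerNr (le_trans (inner_le _ _))// enormN.
Qed.

Lemma norm_inner_norm x y : `|inner x y| <= enorm x * (d%:R * `|y|).
Proof. by rewrite (le_trans (norm_inner_le _ _))// ler_wpM2l ?enorm_ge0 ?ler_enorm_norm. Qed.

End euclidean_norm.

Lemma rV_continuous_at (R : realType) (d : nat) (f : 'rV[R]_d -> R) (x : 'rV[R]_d) :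
  (forall e : R, 0 < e ->
    exists2 r : R, 0 < r & forall y : 'rV[R]_d, `|y - x| < r -> `|f y - f x| <= e) ->
  {for x, continuous f}.
Proof.
move=> H; apply/(@cvgrPdist_le _ _ _ (nbhs x)) => e /H[r r0 rf].
apply/nbhs_ballP; exists r => //= y; rewrite mx_norm_ball /ball_/= distrC => /rf.
by rewrite distrC.
Qed.

(** * Clarke subgradients and growth *)

Section hahn_banach.
Variables (R : realType) (V : lmodType R).
Implicit Types (p q : V -> R) (x y e : V).

Definition sublinear p :=
  (forall x y, p (x + y) <= p x + p y) /\
  (forall (c : R) x, 0 <= c -> p (c *: x) = c * p x).

Lemma sublinear0 p : sublinear p -> p 0 = 0.
Proof. by move=> [_ /(_ 0 0 (lexx _))]; rewrite scale0r mul0r. Qed.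

Lemma sublinear_lb p x : sublinear p -> - p (- x) <= p x.
Proof.
move=> subp; rewrite lerNl -subr_ge0 opprK -(sublinear0 subp) -(subrr x) addrC.
exact: subp.1.
Qed.

(* The step of Hahn-Banach: [p] is made linear along one direction at a
   time by the infimal shift x |-> inf_(t >= 0) (p (x + t e) - t p e). *)
Lemma sublinear_refine p e : sublinear p ->
  exists q, [/\ sublinear q, forall x, q x <= p x & q (- e) <= - p e].
Proof.
move=> subp; have [pD pZ] := subp.
pose A x := [set p (x + t *: e) - t * p e | t in [set t : R | 0 <= t]].
have Alb x : lbound (A x) (- p (- x)).
  move=> _ [t t0 <-]; rewrite -pZ// lerBrDr addrC -lerBrDr opprK.
  by rewrite (le_trans _ (pD _ _))// addrAC subrr add0r.
have Ain x (t : R) : 0 <= t -> A x (p (x + t *: e) - t * p e) by exists t.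
have A0 x : A x !=set0 by eexists; apply: (Ain x 0).
have Ale x (t : R) : 0 <= t -> inf (A x) <= p (x + t *: e) - t * p e.
  by move=> t0; apply: ge_inf; [exists (- p (- x)); exact: Alb|exact: Ain].
have Ap x : inf (A x) <= p x.
  by have := Ale x 0 (lexx _); rewrite scale0r mul0r addr0 subr0.
have AD x y : inf (A (x + y)) <= inf (A x) + inf (A y).
  rewrite -lerBlDr; apply: lb_le_inf => // _ [s s0 <-].
  rewrite lerBlDr -lerBlDl; apply: lb_le_inf => // _ [t t0 <-].
  rewrite lerBlDl (le_trans (Ale _ (s + t) (addr_ge0 s0 t0)))//.
  have := pD (x + s *: e) (y + t *: e).
  rewrite addrACA -scalerDl; lra.
have AZ (c : R) x : 0 < c -> inf (A (c *: x)) <= c * inf (A x).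
  move=> c0; rewrite -ler_pdivrMl//; apply: lb_le_inf => // _ [t t0 <-].
  rewrite ler_pdivrMl//; have := Ale (c *: x) (c * t) (mulr_ge0 (ltW c0) t0).
  by rewrite -scalerA -scalerDr (pZ _ _ (ltW c0)) mulrBr mulrA.
exists (fun x => inf (A x)); split => //.
- split=> // c x; rewrite le_eqVlt => /predU1P[<-|c0].
    rewrite scale0r mul0r; apply/le_anti; rewrite -{1}(sublinear0 subp) Ap/=.
    by apply: lb_le_inf => // a /Alb; rewrite oppr0 (sublinear0 subp) oppr0.
  apply/le_anti; rewrite AZ//= -ler_pdivlMl//.
  by rewrite -{1}[x]scale1r -(@mulVf _ c) ?gt_eqF// -scalerA AZ ?invr_gt0.
- by rewrite (le_trans (Ale _ 1 ler01))// scale1r addNr (sublinear0 subp) mul1r sub0r.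
Qed.

(** Linearity along earlier directions survives later refinements r <= q: r (- x) <= q (- x) <= - q
    x <= - r x. *)
Lemma sublinear_refine_seq p (s : seq V) : sublinear p ->
  exists q, [/\ sublinear q, forall x, q x <= p x &
    forall e, e \in s -> q (- e) <= - q e].
Proof.
move=> subp; elim: s => [|e s [q [subq qp qs]]]; first by exists p.
have [r [subr rq re]] := sublinear_refine e subq.
exists r; split => [//|x|x]; first exact: le_trans (rq x) (qp x).
rewrite inE => /predU1P[->|xs]; first by rewrite (le_trans re)// lerN2.
by rewrite (le_trans (rq _))// (le_trans (qs _ xs))// lerN2.
Qed.

End hahn_banach.

(** Refinement along the basis vectors leaves a linear functional, represented by [zeta]. The
    refinement along v comes before it and forces equality at v: - <zeta, v> = <zeta, - v> <= p1 (-
    v) <= - p v. *)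
Lemma hahn_banach_rV (R : realType) (d : nat) (p : 'rV[R]_d -> R) (v : 'rV[R]_d) :
  sublinear p ->
  exists zeta, (forall w, inner zeta w <= p w) /\ inner zeta v = p v.
Proof.
move=> subp; have [p1 [subp1 p1p p1v]] := sublinear_refine v subp.
have [q [subq qp1 qe]] :=
  sublinear_refine_seq [seq (delta_mx 0 i : 'rV[R]_d) | i <- enum 'I_d] subp1.
pose zeta : 'rV[R]_d := \row_i q (delta_mx 0 i).
have zZ i c : q (c *: (delta_mx 0 i : 'rV[R]_d)) <= c * zeta 0 i.
  rewrite mxE; have [c0|c0] := leP 0 c; first by rewrite subq.2.
  have cN : 0 <= - c by rewrite oppr_ge0 ltW.
  rewrite -[c in leLHS]opprK scaleNr -scalerN (subq.2 _ _ cN) -[leRHS]mulrNN.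
  rewrite ler_wpM2l//.
  by rewrite qe// map_f// mem_enum.
have qz w : q w <= inner zeta w.
  rewrite {1}(row_sum_delta w) innerC /inner.
  elim/big_ind2: _ => [|x1 x2 y1 y2 h1 h2|i _]; first by rewrite (sublinear0 subq).
    by rewrite (le_trans (subq.1 _ _))// lerD.
  exact: zZ.
have zq w : inner zeta w <= q w.
  by rewrite (le_trans _ (sublinear_lb w subq))// lerNr -innerNr qz.
exists zeta; split => [w|]; first by rewrite (le_trans (zq w))// (le_trans (qp1 w)).
apply/le_anti; rewrite (le_trans (zq v)) ?(le_trans (qp1 v))//=.
rewrite -[leRHS]opprK lerNr -innerNr (le_trans (zq _))//.
exact: le_trans (qp1 _) p1v.
Qed.

Section clarke_growth.
Variables (R : realType) (d : nat) (f : 'rV[R]_d -> R).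
Implicit Types (x y z v w zeta : 'rV[R]_d).

(** The eventual upper bounds of the quotients; their infimum [clarke_dir] is the limsup f°(x;
    v). *)
Definition clarke_ub x v : set R := [set c | exists2 r, 0 < r & forall y t,
  enorm (y - x) < r -> 0 < t -> t < r -> (f (y + t *: v) - f y) / t <= c].

Definition clarke_dir x v := inf (clarke_ub x v).

Hypothesis flip : locally_lipschitz f.

Lemma clarke_ub_lip x : exists2 L, 0 <= L &
  forall v, clarke_ub x v (L * enorm v) /\ lbound (clarke_ub x v) (- (L * enorm v)).
Proof.
have [r [r0 [L fL]]] := flip x.
exists `|L| => // v.
(* Since s (1 + |v|) = r, both y and y + t v stay in the ball where f is L-Lipschitz. *)
pose s := r / (1 + enorm v).
have v0 : 0 < 1 + enorm v by rewrite ltr_pwDl ?enorm_ge0.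
have s0 : 0 < s by rewrite divr_gt0.
have sr : s <= r by rewrite ler_pdivrMr// (ler_peMr (ltW r0))// lerDl enorm_ge0.
have H y (t : R) : enorm (y - x) < s -> 0 < t -> t < s ->
    `|(f (y + t *: v) - f y) / t| <= `|L| * enorm v.
  move=> yx t0 ts; rewrite normrM normfV ler_pdivrMr ?normr_gt0 ?gt_eqF//.
  have := fL (y + t *: v) y.
  rewrite [_ - y]addrAC subrr add0r enormZ => /(_ _ _)/le_trans -> //.
  - rewrite addrAC (le_lt_trans (enormD _ _))// enormZ gtr0_norm//.
    rewrite (@lt_le_trans _ _ (s + s * enorm v))//.
      by rewrite ltr_leD// ler_wpM2r ?enorm_ge0// ltW.
    by rewrite -[X in X + _]mulr1 -mulrDr /s divfK// gt_eqF.
  - exact: lt_le_trans yx sr.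
  - by rewrite (mulrC `|t|) mulrA ler_wpM2r// ler_wpM2r ?enorm_ge0// ler_norm.
split; first by exists s => // y t yx t0 ts; rewrite (le_trans (ler_norm _)) ?H.
move=> c [q q0 qc].
pose t := Num.min s q / 2.
have m0 : 0 < Num.min s q by rewrite lt_min s0.
have t0 : 0 < t by rewrite divr_gt0.
have tm : t < Num.min s q by rewrite ltr_pdivrMr// mulr_natr mulr2n ltrDl.
move: tm; rewrite lt_min => /andP[ts tq].
rewrite (le_trans _ (qc x t _ t0 tq)) ?subrr ?enorm0// lerNl.
by rewrite (le_trans (ler_norm _))// normrN H// subrr enorm0.
Qed.

Lemma clarke_dir_gt x v c : clarke_dir x v < c -> clarke_ub x v c.
Proof.
have [L L0 /(_ v)[H1 _]] := clarke_ub_lip x.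
have u0 : clarke_ub x v !=set0 by eexists; exact: H1.
move=> /(inf_lt u0)[c' [r r0 rc'] c'c].
by exists r => // y t yx t0 tr; rewrite (le_trans (rc' _ _ yx t0 tr))// ltW.
Qed.

Lemma clarke_dir_lb x v c : clarke_ub x v c -> clarke_dir x v <= c.
Proof.
have [L L0 /(_ v)[H1 H2]] := clarke_ub_lip x.
by move=> h; apply: ge_inf => //; exists (- (L * enorm v)).
Qed.

(** Subadditivity relies on the base point being free: the quotient along v + w splits at y + t w,
    which is again a base point close to x. *)
Lemma clarke_dir_sublinear x : sublinear (clarke_dir x).
Proof.
have addr_le v w : clarke_dir x (v + w) <= clarke_dir x v + clarke_dir x w.
  apply/ler_addgt0Pr => e e0.
  have e20 : 0 < e / 2 by rewrite divr_gt0.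
  have /clarke_dir_gt[r r0 rv] : clarke_dir x v < clarke_dir x v + e / 2.
    by rewrite ltrDl.
  have /clarke_dir_gt[s s0 sw] : clarke_dir x w < clarke_dir x w + e / 2.
    by rewrite ltrDl.
  apply: clarke_dir_lb.
  have w0 : 0 < 1 + enorm w by rewrite ltr_pwDl ?enorm_ge0.
  pose r' := r / (1 + enorm w).
  have r'0 : 0 < r' by rewrite divr_gt0.
  have r'r : r' <= r by rewrite ler_pdivrMr// (ler_peMr (ltW r0))// lerDl enorm_ge0.
  exists (Num.min r' s); first by rewrite lt_min r'0.
  move=> y t; rewrite !lt_min => /andP[yr ys] t0 /andP[tr ts].
  have := sw _ _ ys t0 ts.
  move=> h2.
  have h1 : (f (y + t *: w + t *: v) - f (y + t *: w)) / t <= clarke_dir x v + e / 2.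
    apply: rv => //; last exact: lt_le_trans tr r'r.
    rewrite addrAC (le_lt_trans (enormD _ _))// enormZ gtr0_norm//.
    rewrite (@lt_le_trans _ _ (r' + r' * enorm w))//.
      by rewrite ltr_leD// ler_wpM2r ?enorm_ge0// ltW.
    by rewrite -[X in X + _]mulr1 -mulrDr /r' divfK// gt_eqF.
  have -> : (f (y + t *: (v + w)) - f y) / t =
    (f (y + t *: w + t *: v) - f (y + t *: w)) / t + (f (y + t *: w) - f y) / t.
    by rewrite (addrC v) scalerDr addrA; ring.
  lra.
have scale_le (c : R) v : 0 < c -> clarke_dir x (c *: v) <= c * clarke_dir x v.
  move=> c0; rewrite -ler_pdivrMl//; apply/ler_addgt0Pr => e e0.
  have /clarke_dir_gt[r r0 rv] : clarke_dir x v < clarke_dir x v + e.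
    by rewrite ltrDl.
  rewrite ler_pdivrMl//; apply: clarke_dir_lb.
  exists (Num.min r (r / c)); first by rewrite lt_min r0 divr_gt0.
  move=> y t; rewrite !lt_min => /andP[yr _] t0 /andP[_ trc].
  have := rv y (t * c) yr (mulr_gt0 t0 c0); rewrite -ltr_pdivlMr// => /(_ trc).
  by rewrite -scalerA invfM mulrA ler_pdivrMr// [leRHS]mulrC.
split=> // c v; rewrite le_eqVlt => /predU1P[<-|c0].
  have [L L0 /(_ 0)[]] := clarke_ub_lip x.
  rewrite scale0r mul0r enorm0 mulr0 oppr0 => H1 H2.
  by apply/le_anti; rewrite clarke_dir_lb//= lb_le_inf//; exists 0.
apply/le_anti; rewrite scale_le//= -ler_pdivlMl//.
by rewrite -{1}[v]scale1r -(@mulVf _ c) ?gt_eqF// -scalerA scale_le ?invr_gt0.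
Qed.

Lemma clarke_dir_attained x v : exists2 zeta, clarke f x zeta &
  inner zeta v = clarke_dir x v.
Proof.
have [zeta [zle zv]] := hahn_banach_rV v (clarke_dir_sublinear x).
(* If the condition of [clarke] failed for w, then <zeta, w> - eta would be an eventual upper bound
   of the quotients, below f°(x; w). *)
exists zeta => // w eta r eta0 r0; apply: contrapT => H.
have /clarke_dir_lb : clarke_ub x w (inner zeta w - eta).
  exists r => // y t yx t0 tr; rewrite leNgt; apply/negP => lt.
  by apply: H; exists y, t.
have := zle w; lra.
Qed.

Lemma locally_lipschitz_continuous : continuous f.
Proof.
move=> x; apply: rV_continuous_at => e e0.
have [r [r0 [L fL]]] := flip x.
(* [d.+1] instead of d keeps the radius meaningful in dimension 0. *)
have d0 : 0 < d.+1%:R :> R by rewrite ltr0n.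
have L0 : 0 < `|L| + 1 by rewrite ltr_wpDl.
exists (Num.min r (e / (`|L| + 1)) / d.+1%:R).
  by rewrite divr_gt0// lt_min r0 divr_gt0.
move=> y; rewrite ltr_pdivlMr// lt_min => /andP[yr ye].
have yd : enorm (y - x) <= `|y - x| * d.+1%:R.
  by rewrite (le_trans (ler_enorm_norm _))// mulrC ler_wpM2l// ler_nat.
rewrite (le_trans (fL _ _ (le_lt_trans yd yr) _)) ?subrr ?enorm0//.
rewrite (le_trans (ler_wpM2r (enorm_ge0 _) (ler_norm L)))//.
have := le_trans yd (ltW ye); rewrite ler_pdivlMr// mulrC; apply: le_trans.
by rewrite ler_wpM2r ?enorm_ge0// lerDl.
Qed.

End clarke_growth.

(** * Mean value inequality from Dini derivatives *)

Section dini.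
Variable R : realType.

(** A continuity argument for h s = g s - g 0 - (M + e) s: let c be the supremum of the s such that
    h <= 0 on [0, s]. Continuity gives h c <= 0, and the slope bound at c extends this beyond c
    unless c = 1. *)
Lemma dini_le (g : R -> R) (M : R) : continuous g ->
  (forall s e : R, 0 <= s < 1 -> 0 < e ->
     exists2 r, 0 < r & forall t, 0 < t -> t < r -> g (s + t) - g s <= (M + e) * t) ->
  g 1 - g 0 <= M.
Proof.
move=> cg dg; apply/ler_addgt0Pr => e e0.
pose h s := g s - g 0 - (M + e) * s.
have ch : continuous h.
  move=> s; apply: cvgB; last by apply: cvgMr; exact: cvg_id.
  by apply: cvgB; [exact: cg|exact: cvg_cst].
suff : h 1 <= 0 by rewrite /h mulr1 subr_le0.
pose S := [set s : R | 0 <= s <= 1 /\ forall s', 0 <= s' -> s' <= s -> h s' <= 0].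
have h0 : h 0 = 0 by rewrite /h mulr0 !subrr.
have S0 : S 0.
  split=> [|s' s'0 s'0']; first by rewrite lexx ler01.
  by have -> : s' = 0 by [apply/le_anti; rewrite s'0 s'0']; rewrite h0.
have ubS : ubound S 1 by move=> s [/andP[]].
have supS : has_sup S by split; [exists 0|exists 1].
set c := sup S.
have c0 : 0 <= c by apply: ub_le_sup => //; exists 1.
have c1 : c <= 1 by apply: ge_sup => //; exists 0.
have hlt s : 0 <= s -> s < c -> h s <= 0.
  move=> s0 sc.
  have [t [_ tS] st] := sup_gt supS.1 sc.
  by apply: tS => //; exact: ltW.
have hc : h c <= 0.
  rewrite leNgt; apply/negP => hc.
  have [cE|cn0] := eqVneq c 0; first by move: hc; rewrite cE h0 ltxx.
  have cp : 0 < c by rewrite lt_neqAle eq_sym cn0.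
  have /cvgr_gt /(_ _ hc) := ch c.
  move=> [r /= r0 rh].
  pose s := Num.max 0 (c - r / 2).
  have sc : s < c by rewrite gt_max cp/= ltrBlDr ltrDl divr_gt0.
  have : 0 < h s.
    apply: rh => /=; rewrite gtr0_norm ?subr_gt0// ltrBlDr -ltrBlDl lt_max.
    by apply/orP; right; rewrite ltrD2l ltrN2 ltr_pdivrMr// mulr_natr mulr2n ltrDl.
  by rewrite ltNge hlt// le_max lexx.
have [->//|cn1] := eqVneq 1 c.
have clt1 : c < 1 by rewrite lt_neqAle eq_sym cn1.
have [|r r0 rg] := dg c e _ e0; first by rewrite c0.
pose t := Num.min r (1 - c) / 2.
have m0 : 0 < Num.min r (1 - c) by rewrite lt_min r0 subr_gt0.
have t0 : 0 < t by rewrite divr_gt0.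
have : t < Num.min r (1 - c) by rewrite ltr_pdivrMr// mulr_natr mulr2n ltrDl.
rewrite lt_min => /andP[tr tc].
suff : S (c + t).
  by move=> /(ub_le_sup (ex_intro _ _ ubS)); rewrite -/c gerDl leNgt t0.
split; first by rewrite addr_ge0 ?(ltW t0)//= -lerBrDl ltW.
move=> s s0; rewrite -lerBlDl => sct.
have [sc|sc] := leP s c.
  by move: sc; rewrite le_eqVlt => /predU1P[->//|/hlt]; exact.
have := rg (s - c); rewrite subr_gt0 sc subrKC => /(_ isT (le_lt_trans sct tr)).
by move: hc; rewrite /h; lra.
Qed.

End dini.

Section clarke_lipschitz.
Variables (R : realType) (d : nat) (f : 'rV[R]_d -> R).
Hypothesis flip : locally_lipschitz f.

Lemma clarke_bounded_le (M : R) (y z : 'rV[R]_d) :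
  (forall (s : R) zeta, 0 <= s < 1 -> clarke f (y + s *: (z - y)) zeta -> enorm zeta <= M) ->
  f z - f y <= M * enorm (z - y).
Proof.
move=> fM; set v := z - y.
have zE : z = y + v by rewrite /v subrKC.
have := @dini_le R (fun s => f (y + s *: v)) (M * enorm v).
rewrite scale1r scale0r addr0 -zE; apply.
  move=> s; apply: continuous_comp; last exact: locally_lipschitz_continuous.
  by apply: cvgD; [exact: cvg_cst|apply: cvgZl; exact: cvg_id].
move=> s e s01 e0.
have [zeta fzeta zv] := clarke_dir_attained flip (y + s *: v) v.
have : clarke_dir f (y + s *: v) v < M * enorm v + e.
  rewrite -zv (le_lt_trans (inner_le _ _))// ltr_pwDr//.
  by rewrite ler_wpM2r ?enorm_ge0// (fM s).
move=> /(clarke_dir_gt flip)[r r0 rv]; exists r => // t t0 tr.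
have := rv (y + s *: v) t; rewrite subrr enorm0 => /(_ r0 t0 tr).
by rewrite ler_pdivrMr// scalerDl addrA.
Qed.

Lemma SPB_lipschitz (R1 R2 : R) (m : nat) (r : R) (y z : 'rV[R]_d) :
  SPB f R1 R2 m -> enorm y <= r -> enorm z <= r ->
  `|f y - f z| <= (R1 * r ^+ m + R2) * enorm (y - z).
Proof.
move=> [R10 [_ [_ [_ fR]]]] yr zr.
have seg (a b : 'rV[R]_d) : enorm a <= r -> enorm b <= r ->
    f b - f a <= (R1 * r ^+ m + R2) * enorm (b - a).
  move=> ar br; apply: clarke_bounded_le => s zeta /andP[s0 s1] /fR/le_trans; apply.
  have r0 : 0 <= r := le_trans (enorm_ge0 _) ar.
  rewrite lerD2r ler_wpM2l// lerXn2r ?nnegrE ?enorm_ge0//.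
  have -> : a + s *: (b - a) = (1 - s) *: a + s *: b.
    by rewrite scalerBr scalerBl scale1r addrAC addrA.
  rewrite (le_trans (enormD _ _))// !enormZ !ger0_norm ?subr_ge0 ?(ltW s1)//.
  rewrite (@le_trans _ _ ((1 - s) * r + s * r))//.
    by rewrite lerD ?ler_wpM2l// subr_ge0 ltW.
  by rewrite -mulrDl subrK mul1r.
by rewrite ler_norml lerNl opprB enormB {1}seg//= -enormB seg.
Qed.

End clarke_lipschitz.

Lemma inner_grad (R : realType) (d : nat) (f : 'rV[R]_d -> R) (x v : 'rV[R]_d) :
  inner (grad f x) v = 'd f x v.
Proof.
rewrite [in RHS](row_sum_delta v) linear_sum; apply: eq_bigr => i _.
by rewrite linearZ mxE mulrC.
Qed.

Lemma grad_clarke (R : realType) (d : nat) (f : 'rV[R]_d -> R) (x : 'rV[R]_d) :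
  differentiable f x -> clarke f x (grad f x).
Proof.
(* The base point is x itself; only t has to be small. *)
move=> df v e r e0 r0; exists x.
have := @diff_derivable _ _ _ f x v df; rewrite /derivable => /cvg_ex[/= l fl].
have lE : l = inner (grad f x) v.
  by rewrite inner_grad -deriveE//; apply/esym/cvg_lim.
move: fl; rewrite lE => /cvgr_gt/(_ (inner (grad f x) v - e)).
rewrite ltrBlDr ltrDl => /(_ e0)[s /= s0 H].
pose t := Num.min r s / 2.
have m0 : 0 < Num.min r s by rewrite lt_min r0.
have t0 : 0 < t by rewrite divr_gt0.
have : t < Num.min r s by rewrite ltr_pdivrMr// mulr_natr mulr2n ltrDl.
rewrite lt_min => /andP[tr ts].
exists t; rewrite subrr enorm0; split=> //; split=> //; split=> //.
have := H t; rewrite /ball_/= sub0r normrN gtr0_norm// => /(_ ts (lt0r_neq0 t0)).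
by rewrite (addrC x) [X in _ -> _ < X]mulrC.
Qed.

(** * Almost everywhere derivability on the line *)

Section lipschitz_derivable.
Variable R : realType.
Local Notation mu := (@lebesgue_measure R).

Lemma stieltjes_ocitv (G : cumulative R R) (a b : R) : a <= b ->
  lebesgue_stieltjes_measure G `]a, b]%classic = (G b - G a)%:E.
Proof.
move=> ab; rewrite /lebesgue_stieltjes_measure /measure_extension measurable_mu_extE/=; last exact: is_ocitv.
by rewrite wlength_itv_bnd.
Qed.

(* The Stieltjes measures of K s + g and K s - g add up to 2 K times the Lebesgue
   measure, so the first one has a density and Lebesgue differentiation applies. *)
Lemma lipschitz_ae_derivable (g : R -> R) (L a b : R) :
  (forall s t, `|g s - g t| <= L * `|s - t|) ->
  {ae mu, forall s, a < s < b -> derivable g s 1}.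
Proof.
move=> gL; pose K := `|L| + 1.
have K0 : 0 < K by rewrite ltr_wpDl.
have gK s t : s <= t -> `|g t - g s| <= K * (t - s).
  move=> st; rewrite (le_trans (gL t s))// ger0_norm ?subr_ge0//.
  by rewrite ler_wpM2r ?subr_ge0// (le_trans (ler_norm L))// lerDl.
have cg : continuous g.
  move=> s; apply/cvgrPdist_le => /= e e0; near=> t.
  have H : `|g s - g t| <= K * `|s - t|.
    by rewrite (le_trans (gL s t))// ler_wpM2r// (le_trans (ler_norm L))// lerDl.
  rewrite (le_trans H)// -ler_pdivlMl//; near: t.
  by apply: cvgr_dist_le => //; rewrite mulr_gt0 ?invr_gt0.
pose G1 s := K * s + g s.
pose G2 s := K * s - g s.
have cG1 : continuous G1.
  by move=> s; apply: cvgD; [apply: cvgMr; exact: cvg_id|exact: cg].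
have cG2 : continuous G2.
  by move=> s; apply: cvgB; [apply: cvgMr; exact: cvg_id|exact: cg].
have nd1 : {homo G1 : x y / x <= y}.
  by move=> s t /gK; rewrite /G1 ler_norml => /andP[]; lra.
have nd2 : {homo G2 : x y / x <= y}.
  by move=> s t /gK; rewrite /G2 ler_norml => /andP[]; lra.
pose c1 : cumulative R R := HB.pack G1
  (isCumulative.Build R _ R G1 nd1 (right_continuousW cG1)).
pose c2 : cumulative R R := HB.pack G2
  (isCumulative.Build R _ R G2 nd2 (right_continuousW cG2)).
pose nu1 := lebesgue_stieltjes_measure c1.
pose nu2 := lebesgue_stieltjes_measure c2.
have K2 : 0 <= (2 * K)^-1 by rewrite invr_ge0 mulr_ge0// ltW.
pose m : {measure set (measurableTypeR R) -> \bar R} :=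
  mscale (NngNum K2) (measure_add nu1 nu2).
have m_add A : m A = ((2 * K)^-1%:E * (nu1 A + nu2 A))%E.
  by rewrite /m/= /mscale/= /msum !big_ord_recl big_ord0/= adde0.
have mE A : measurable A -> mu A = m A.
  apply: lebesgue_measure_unique => X /ocitvP[->|[[x y] /= xy ->]].
    by rewrite !measure0.
  rewrite m_add [LHS](stieltjes_ocitv idfun (ltW xy)).
  rewrite /nu1 /nu2 (stieltjes_ocitv c1 (ltW xy)) (stieltjes_ocitv c2 (ltW xy))/=.
  rewrite -EFinD -EFinM; congr EFin.
  rewrite /G1 /G2; field.
  by rewrite gt_eqF.
pose D : set (measurableTypeR R) := `]a, b]%classic.
have [ba|ab] := leP b a.
  apply: aeW => s /andP[sa sb].
  by have := lt_trans sa sb; rewrite ltNge ba.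
have mD : measurable D by exact: measurable_itv.
have nuD : (nu1 D < +oo)%E by rewrite /nu1 /D stieltjes_ocitv ?ltry// ltW.
(* Restricting to ]a, b] makes the Stieltjes measure finite, ready for Radon-Nikodym; it is
   dominated because nu1 + nu2 is 2 K times the Lebesgue measure. *)
pose nu : {finite_measure set (measurableTypeR R) -> \bar R} := mfrestr mD nuD.
have numu : nu `<< mu.
  apply/null_content_dominatesP => A mA muA.
  suff nu0 : nu1 A = 0%E.
    apply/eqP; rewrite eq_le measure_ge0 andbT -nu0.
    rewrite /nu/= /mfrestr /mrestr; apply: (le_measure nu1); rewrite ?inE//.
    exact: measurableI.
  have := mE _ mA; rewrite [mu A]muA m_add.
  move=> /esym/eqP; rewrite mule_eq0 eqe invr_eq0 mulf_eq0 pnatr_eq0/= gt_eqF//=.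
  by rewrite padde_eq0 ?measure_ge0// => /andP[/eqP].
have [f [f0 ffin fint fE]] := radon_nikodym_sigma_finite numu.
pose h := fine \o f.
have hE : EFin \o h = f by apply/funext => x /=; rewrite fineK.
have hint : mu.-integrable setT (EFin \o h) by rewrite hE.
have /lebesgue_differentiation : locally_integrable setT h.
  exact: open_integrable_locally openT hint.
apply: filterS; first exact: (ae_filter_ringOfSetsType mu).
move=> s hs /andP[sa sb].
(* Near s this primitive of the density equals G1 y - G1 a, so derivability of F at a Lebesgue point
   passes to G1 and then to g = G1 - K id. *)
pose F y := (\int[mu]_(t in [set` Interval (BRight a) (BRight y)]) (h t))%R.
have hi : mu.-integrable `]a, b] (EFin \o h).
  by apply: integrableS hint => //; exact: measurable_itv.
have [dF _] := FTC1_lebesgue_pt sb hi sa hs.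
have FE y : a < y -> y < b -> F y = G1 y - G1 a.
  move=> ay yb; rewrite /F /Rintegral.
  have nuE : nu `]a, y]%classic = (G1 y - G1 a)%:E.
    rewrite /nu/= /mfrestr /mrestr /nu1 -(stieltjes_ocitv c1 (ltW ay)).
    congr (_ _); apply/setIidl => t; rewrite /D/= !in_itv/= => /andP[-> /le_trans].
    by apply; exact: ltW.
  transitivity (fine (nu `]a, y]%classic)); last by rewrite nuE.
  rewrite fE//=.
  by congr fine; apply: eq_integral => t _; rewrite -[in RHS]hE.
have dG : derivable (fun y => G1 y - G1 a) s 1.
  apply: near_eq_derivable dF.
  near=> y; apply: FE; near: y; first exact: lt_nbhsr.
  exact: lt_nbhsl.
have -> : g = (fun y => G1 y - G1 a) + cst (G1 a) - (K *: id).
  by apply/funext => y /=; rewrite !fctE /G1; rewrite /GRing.scale/=; ring.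
apply: derivableB; first by apply: derivableD; [exact: dG|exact: derivable_cst].
by apply: derivableZ; exact: derivable_id.
Unshelve. all: by end_near. Qed.

End lipschitz_derivable.

(** * Measurability of continuous functions of a vector *)

Lemma ler_norm_rV (R : realType) (d : nat) (x : 'rV[R]_d) (e : R) :
  0 <= e -> (forall i, `|x 0 i| <= e) -> `|x| <= e.
Proof.
move=> e0 xe; rewrite [`|x|]mx_normrE; apply: bigmax_le => // -[i j] _ /=.
by rewrite ord1.
Qed.

Lemma measurable_forall_ord (d : measure_display) (T : measurableType d) (n : nat)
  (A : 'I_n -> set T) : (forall i, measurable (A i)) ->
  measurable [set t | forall i, A i t].
Proof.
move=> mA; have -> : [set t | forall i, A i t] = \bigcap_(i in [set: 'I_n]) A i.
  by apply/seteqP; split => [t At i _|t At i]; exact: At.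
by apply: fin_bigcap_measurable => //; exact: finite_finset.
Qed.

(** Measurability of [phi] is only given coordinatewise. Rounding down to the grid of mesh 1/(n+1)
    gives functions with countably many values on measurable cells, and they converge pointwise by
    continuity of F. *)
Lemma measurable_continuous_rV (R : realType) (d : nat) (d' : measure_display)
  (T : measurableType d') (phi : T -> 'rV[R]_d) (F : 'rV[R]_d -> R) :
  (forall i, measurable_fun setT (fun t => phi t 0 i)) -> continuous F ->
  measurable_fun setT (fun t => F (phi t)).
Proof.
move=> mphi cF.
pose pt (n : nat) (k : {ffun 'I_d -> int}) : 'rV[R]_d :=
  \row_i ((k i)%:~R / n.+1%:R).
pose fl (n : nat) (t : T) : {ffun 'I_d -> int} :=
  [ffun i => Num.floor (n.+1%:R * phi t 0 i)].
apply: (measurable_fun_cvg (h := fun n t => F (pt n (fl n t)))) => [n|t _].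
- move=> _ Y mY; rewrite setTI.
  have -> : (fun t => F (pt n (fl n t))) @^-1` Y =
      \bigcup_(k in [set: {ffun 'I_d -> int}])
        [set t | Y (F (pt n k)) /\ forall i, Num.floor (n.+1%:R * phi t 0 i) = k i].
    apply/seteqP; split => [t Yt|t [k _ [Yk fk]]].
      by exists (fl n t) => //; split=> // i; rewrite ffunE.
    rewrite /preimage/=; have -> : fl n t = k by apply/ffunP => i; rewrite ffunE fk.
    exact: Yk.
  apply: countable_bigcupT_measurable => [|k]; first exact: countableP.
  have [Yk|nYk] := pselect (Y (F (pt n k))); last first.
    by rewrite (_ : [set _ | _] = set0)//; apply/seteqP; split => // t [].
  rewrite (_ : [set _ | _] =
    [set t | forall i, Num.floor (n.+1%:R * phi t 0 i) = k i]); last first.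
    by apply/seteqP; split => t //= [].
  apply: measurable_forall_ord => i.
  rewrite [X in measurable X](_ : _ =
     (fun t => n.+1%:R * phi t 0 i) @^-1` `[(k i)%:~R, (k i + 1)%:~R[); last first.
    apply/seteqP; split => t /=; rewrite in_itv/=.
      by move=> <-; exact: floor_itv.
    by move=> H; apply: floor_def.
  rewrite -[X in measurable X]setTI.
  by apply: measurable_funM => //; exact: measurable_itv.
- apply: (@cvg_comp _ _ _ (fun n => pt n (fl n t)) F _ (nbhs (phi t))); last exact: cF.
  apply/cvgrPdist_le => e e0; near=> n.
  apply: ler_norm_rV => [|i]; first exact: ltW.
  rewrite !mxE ffunE.
  set x := phi t 0 i; have n0 : 0 < n.+1%:R :> R by rewrite ltr0n.
  have /andP[h1 h2] := floor_itv (n.+1%:R * x).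
  rewrite (_ : x - _ = (n.+1%:R * x - (Num.floor (n.+1%:R * x))%:~R) / n.+1%:R); last first.
    by field; rewrite addrC natr1 gt_eqF.
  rewrite normrM normfV (gtr0_norm n0) ler_pdivrMr// ger0_norm ?subr_ge0//.
  rewrite (@le_trans _ _ 1)//; first by move: h2; rewrite intrD; lra.
  rewrite -ler_pdivrMl// mulr1 -natr1 -lerBlDr.
  near: n; exact: nbhs_infty_ger.
Unshelve. all: by end_near. Qed.

(** * Gaussian integrals *)

Section density.
Context (d : measure_display) (T : measurableType d) (R : realType).
Variables (mu : {measure set T -> \bar R}) (w : T -> R).

(** The proofs [mw] and [w0] are arguments so that the measure structure declared below can be
    attached to the definition. *)
Definition density (mw : measurable_fun setT w) (w0 : forall x, 0 <= w x) (A : set T) : \bar R :=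
  (\int[mu]_(x in A) (w x)%:E)%E.

Hypotheses (mw : measurable_fun setT w) (w0 : forall x, 0 <= w x).
Local Notation nu := (density mw w0).

Let nu0 : nu set0 = 0%E.
Proof. by rewrite /density integral_set0. Qed.

Let nu_ge0 A : (0 <= nu A)%E.
Proof. by apply: integral_ge0 => x _; rewrite lee_fin. Qed.

Let nu_sigma_additive : semi_sigma_additive nu.
Proof.
apply: semi_sigma_additive_nng_induced => [|x]; last by rewrite lee_fin.
exact/measurable_EFinP.
Qed.

HB.instance Definition _ := isMeasure.Build _ _ _ nu nu0 nu_ge0 nu_sigma_additive.

Import HBNNSimple.

Let integral_density_nnsfun (h : {nnsfun T >-> R}) :
  (\int[nu]_x (h x)%:E = \int[mu]_x ((h x)%:E * (w x)%:E))%E.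
Proof.
under [LHS]eq_integral do rewrite fimfunE -fsumEFin//.
rewrite [LHS]ge0_integral_fsum//; last 2 first.
  - by move=> r; exact/measurable_EFinP/measurableT_comp.
  - by move=> n x _; rewrite EFinM nnfun_muleindic_ge0.
under [RHS]eq_integral.
  move=> x xD; rewrite fimfunE -fsumEFin// ge0_mule_fsuml; last first.
    by move=> r; rewrite EFinM nnfun_muleindic_ge0.
  over.
rewrite [RHS]ge0_integral_fsum//; last 2 first.
  - move=> r; apply: emeasurable_funM; last exact/measurable_EFinP.
    by apply/measurable_EFinP; do 2 apply/measurableT_comp => //.
  - by move=> n x _; rewrite EFinM mule_ge0// ?lee_fin// -lee_fin EFinM nnfun_muleindic_ge0.
apply: eq_fsbigr => r /[!inE] -[x _ hxr].
rewrite integralZl_indic_nnsfun//= integral_indic// setIT.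
have r0 : 0 <= r by rewrite -hxr.
under [RHS]eq_integral do rewrite EFinM -muleA.
rewrite [RHS]ge0_integralZl//; last 2 first.
  - apply: emeasurable_funM; last exact/measurable_EFinP.
    exact/measurable_EFinP/measurable_indic.
  - by move=> y _; rewrite mule_ge0// lee_fin.
congr (_ * _)%E; rewrite /= /density [LHS]integral_mkcond; apply: eq_integral => y _.
by rewrite patchE indicE; case: ifPn; rewrite ?mul1e ?mul0e.
Qed.

Lemma integral_density (g : T -> \bar R) : measurable_fun setT g ->
  (forall x, (0 <= g x)%E) ->
  (\int[nu]_x g x = \int[mu]_x (g x * (w x)%:E))%E.
Proof.
move=> mg g0; pose g_ := nnsfun_approx measurableT mg.
have gcvg x : (g_ n x)%:E @[n --> \oo] --> g x by exact: cvg_nnsfun_approx.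
have gnd x : {homo (fun n => (g_ n x)%:E) : a b / (a <= b)%N >-> (a <= b)%E}.
  by move=> a b ab; rewrite lee_fin; exact/lefP/nd_nnsfun_approx.
have mgn n : measurable_fun setT (fun x => (g_ n x)%:E) by exact/measurable_EFinP.
transitivity (limn (fun n => (\int[nu]_x (g_ n x)%:E)%E)).
  rewrite -monotone_convergence//=.
  - by apply: eq_integral => x _; apply/esym/cvg_lim.
  - by move=> n x _; rewrite lee_fin.
transitivity (limn (fun n => (\int[mu]_x ((g_ n x)%:E * (w x)%:E))%E)).
  by congr (limn _); apply/funext => n /=; exact: integral_density_nnsfun.
rewrite -monotone_convergence//=.
- apply: eq_integral => x _; apply/cvg_lim => //.
  by apply: cvgeZr => //; exact: gcvg.
- by move=> n; apply: emeasurable_funM => //; exact/measurable_EFinP.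
- by move=> n x _; rewrite mule_ge0// lee_fin.
- by move=> x _ a b ab; rewrite lee_wpmul2r ?lee_fin// -lee_fin gnd.
Qed.

End density.

(** * Orthants as a determining class *)

Section tuple_measure.
Variables (R : realType) (d : nat).

(** Closed under intersection and generating, with boundary inside finitely many coordinate
    hyperplanes. *)
Definition orthant (a : 'I_d -> R) : set (d.-tuple R) :=
  [set t | forall i, tnth t i < a i].

Lemma measurable_orthant a : measurable (orthant a).
Proof.
apply: measurable_forall_ord => i.
rewrite [X in measurable X](_ : _ = (@tnth _ R ^~ i) @^-1` `]-oo, (a i)[); last first.
  by apply/seteqP; split => t /=; rewrite in_itv.
rewrite -[X in measurable X]setTI.
by apply: measurable_tnth => //; exact: measurable_itv.
Qed.

Lemma measurable_tuple_orthant :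
  (measurable : set (set (d.-tuple R))) = <<s range orthant >>.
Proof.
apply/seteqP; split; last first.
  apply: smallest_sub; first exact: sigma_algebra_measurable.
  by move=> _ [a _ <-]; exact: measurable_orthant.
apply: smallest_sub; first exact: smallest_sigma_algebra.
move=> A; rewrite -bigcup_seq => -[i _ [Y mY <-]].
pose T := g_sigma_algebraType (range orthant).
have : measurable_fun setT ((@tnth d R ^~ i) : T -> R).
  apply: (measurability _ (RGenInftyO.measurableE R)) => //.
  move=> _ [_ [x ->] <-]; rewrite setTI.
  (* The half-space where coordinate i is below x is the union over n of the orthants with bound x
     at i and n elsewhere. *)
  rewrite [X in measurable X](_ : _ =
    \bigcup_n (orthant (fun j => if j == i then x else n%:R) : set T)).
    by apply: bigcupT_measurable => n; apply: sub_sigma_algebra; exists (fun j => if j == i then x else n%:R).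
  apply/seteqP; split => t /=; rewrite in_itv/=.
    move=> tx; have [M tM] : exists M : R, forall j, tnth t j < M.
      exists (\sum_j `|tnth t j| + 1) => j; rewrite ltr_pwDr// (bigD1 j)//=.
      by rewrite (le_trans (ler_norm _))// lerDl sumr_ge0.
    exists (Num.truncn M).+1 => // j; case: ifPn => [/eqP ->//|_].
    by rewrite (lt_trans (tM j))// truncnS_gt.
  by move=> [n _ /(_ i)]; rewrite eqxx.
by move=> /(_ measurableT _ mY).
Qed.

Lemma tuple_measure_unique (m1 m2 : {measure set (d.-tuple R) -> \bar R}) :
  (m1 setT < +oo)%E -> (forall a, m1 (orthant a) = m2 (orthant a)) ->
  forall A, measurable A -> m1 A = m2 A.
Proof.
move=> m1T m12.
apply: (@measure_unique _ _ _ (range orthant) (fun n => orthant (fun _ => n%:R))).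
- exact: measurable_tuple_orthant.
- move=> _ _ [a _ <-] [b _ <-]; exists (fun i => Num.min (a i) (b i)) => //.
  apply/seteqP; split => [t tab|t [ta tb] i].
    by split => i; have := tab i; rewrite lt_min => /andP[].
  by rewrite lt_min ta tb.
- by move=> n; exists (fun=> n%:R).
- apply/seteqP; split => // t _.
  exists (Num.truncn (\sum_j `|tnth t j| + 1)).+1 => // j.
  rewrite (lt_trans _ (truncnS_gt _))// ltr_pwDr// (bigD1 j)//=.
  by rewrite (le_trans (ler_norm _))// lerDl sumr_ge0.
- by move=> _ [a _ <-]; exact: m12.
- move=> n; rewrite (le_lt_trans _ m1T)// le_measure ?inE//.
  exact: measurable_orthant.
Qed.

End tuple_measure.

Section normal_integrals.
Variable R : realType.
Local Notation mu := (@lebesgue_measure R).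
Local Notation gamma := (@normal_prob R 0 1).

Lemma integral_normal_prob (g : R -> \bar R) : measurable_fun setT g ->
  (forall x, (0 <= g x)%E) ->
  (\int[gamma]_x g x = \int[mu]_x (g x * (normal_pdf 0 1 x)%:E))%E.
Proof.
move=> mg g0.
rewrite -(@integral_density _ _ _ mu _ (measurable_normal_pdf 0 1) (normal_pdf_ge0 0 1))//.
Qed.

Lemma normal_pdf_expR (m s x : R) : s != 0 ->
  normal_pdf m s x = (Num.sqrt (s ^+ 2 * pi *+ 2))^-1 * expR (- (x - m) ^+ 2 / (s ^+ 2 *+ 2)).
Proof. by move=> s0; rewrite normal_pdfE. Qed.

(** The integrand times the standard density is s times the density of N(0, s^2) with s = (1 - 2
    l)^(-1/2), and that density has mass 1. *)
Lemma normal_mgf_sqr (l : R) : l < 2^-1 ->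
  (\int[gamma]_x (expR (l * x ^+ 2))%:E = ((Num.sqrt (1 - 2 * l))^-1)%:E)%E.
Proof.
move=> l2; have c0 : 0 < 1 - 2 * l by lra.
set s := (Num.sqrt (1 - 2 * l))^-1.
have s0 : 0 < s by rewrite invr_gt0 sqrtr_gt0.
have s2 : s ^+ 2 = (1 - 2 * l)^-1 by rewrite exprVn sqr_sqrtr// ltW.
rewrite integral_normal_prob//; last first.
  apply/measurable_EFinP; apply: measurableT_comp => //.
  by apply: measurable_funM => //; exact: measurable_funX.
transitivity (\int[mu]_x (s%:E * (normal_pdf 0 s x)%:E))%E; last first.
  rewrite ge0_integralZl//.
  - by rewrite integral_normal_pdf mule1.
  - by apply/measurable_EFinP; exact: measurable_normal_pdf.
  - by move=> x _; rewrite lee_fin normal_pdf_ge0.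
  - by rewrite lee_fin ltW.
apply: eq_integral => x _; rewrite -!EFinM; congr EFin.
rewrite !normal_pdf_expR ?gt_eqF// !subr0 !expr1n mulrCA -expRD mul1r.
rewrite -mulrnAr sqrtrM ?sqr_ge0// sqrtr_sqr gtr0_norm// invfM !mulrA.
rewrite divff ?gt_eqF// mul1r; congr (_ * expR _); rewrite s2.
by field; rewrite gt_eqF.
Qed.

Lemma lebesgue_measure_shift (h : R) (A : set R) : measurable A ->
  mu A = mu ((fun x => x + h) @^-1` A).
Proof.
have mh : measurable_fun setT (fun x : measurableTypeR R => x + h : measurableTypeR R).
  by apply: measurable_funD => //.
pose H : {mfun measurableTypeR R >-> measurableTypeR R} :=
  HB.pack (fun x : measurableTypeR R => x + h : measurableTypeR R)
    (isMeasurableFun.Build _ _ _ _ _ mh).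
apply: (@lebesgue_measure_unique R (pushforward mu H)).
move=> _ [[a b] _ <-] /=; rewrite /pushforward.
rewrite (_ : _ @^-1` _ = `]a - h, b - h]%classic); last first.
  by apply/seteqP; split => x /=; rewrite !in_itv/= ltrBlDr lerBrDr.
by rewrite !lebesgue_measure_itv/= !lte_fin ltrD2r -!EFinD; case: ifP => // _; congr EFin; ring.
Qed.

Lemma integral_normal_pdf_shift (h a : R) :
  (\int[mu]_(x in `]-oo, (a - h)%R[) (normal_pdf 0 1 x)%:E =
   \int[mu]_(x in `]-oo, a[) (normal_pdf h 1 x)%:E)%E.
Proof.
have mh : measurable_fun setT (fun x : measurableTypeR R => x + h : measurableTypeR R).
  by apply: measurable_funD => //.
pose H : {mfun measurableTypeR R >-> measurableTypeR R} :=
  HB.pack (fun x : measurableTypeR R => x + h : measurableTypeR R)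
    (isMeasurableFun.Build _ _ _ _ _ mh).
rewrite [RHS](eq_measure_integral (pushforward mu H)); last first.
  by move=> A mA _; exact: lebesgue_measure_shift.
rewrite (ge0_integral_pushforward mh).
- rewrite (_ : _ @^-1` _ = `]-oo, (a - h)[%classic); last first.
    by apply/seteqP; split => x /=; rewrite !in_itv/= ltrBrDr.
  apply: eq_integral => x _; congr EFin.
  by rewrite /= !normal_pdf_expR ?oner_neq0// subr0 addrK.
- exact: measurable_itv.
- by apply/measurable_EFinP/measurable_funTS; exact: measurable_normal_pdf.
- by move=> x _; rewrite lee_fin normal_pdf_ge0.
Qed.

(** One-dimensional Cameron-Martin: exp(h x - h^2/2) is the density of N(h, 1) relative to N(0,
    1). *)
Lemma normal_prob_shift (h a : R) :
  (gamma `]-oo, (a - h)%R[%classic =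
   \int[gamma]_x (expR (h * x - h ^+ 2 / 2) * \1_(`]-oo, a[%classic) x)%:E)%E.
Proof.
rewrite integral_normal_prob; last 2 first.
- apply/measurable_EFinP; apply: measurable_funM; last exact: measurable_indic.
  apply: measurableT_comp => //; exact: measurable_funB.
- by move=> x; rewrite lee_fin mulr_ge0// expR_ge0.
rewrite /normal_prob integral_normal_pdf_shift [LHS]integral_mkcond.
apply: eq_integral => x _; rewrite patchE indicE.
case: ifPn => _; last by rewrite mulr0 mul0e.
rewrite mulr1 -EFinM !normal_pdf_expR ?oner_neq0//; congr EFin.
rewrite mulrCA -expRD; congr (_ * expR _); rewrite subr0 !expr1n.
by field.
Qed.

Lemma integral_normal_indic (B : set R) : measurable B ->
  (\int[gamma]_x (\1_B x)%:E = gamma B)%E.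
Proof. by move=> mB; rewrite integral_indic// setIT. Qed.

End normal_integrals.

(** * Product formula and Cameron-Martin theorem *)

Section gaussian.
Variables (R : realType) (d : nat) (P : probability (d.-tuple R) R).
Hypothesis hP : std_gaussian P.
Local Notation gamma := (@normal_prob R 0 1).

(** Independence for functions, derived from boxes. The indicators are replaced by the functions
    [g i] one coordinate at a time: [G k] uses g on the coordinates below k and indicators from k
    on, so that k = 0 is the definition of [std_gaussian] and k = d is the claim. *)
Lemma std_gaussian_prod (g : 'I_d -> R -> R) :
  (forall i, measurable_fun setT (g i)) -> (forall i x, 0 <= g i x) ->
  (forall i, (\int[gamma]_x (g i x)%:E < +oo)%E) ->
  (\int[P]_t (\prod_(i < d) g i (tnth t i))%:E =
   \prod_(i < d) \int[gamma]_x (g i x)%:E)%E.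
Proof.
move=> mg g0 gfin.
pose G k (A : 'I_d -> set R) (i : 'I_d) : R -> R :=
  if (i < k)%N then g i else \1_(A i).
have mG k A i : (forall i, measurable (A i)) -> measurable_fun setT (G k A i).
  by move=> mA; rewrite /G; case: ifPn => _; [exact: mg|exact: measurable_indic].
have G0 k A i x : 0 <= G k A i x by rewrite /G; case: ifPn.
have Gfin k A i : (forall i, measurable (A i)) ->
    (\int[gamma]_x (G k A i x)%:E)%E \is a fin_num.
  move=> mA; rewrite ge0_fin_numE; last by apply: integral_ge0 => x _; rewrite lee_fin.
  rewrite /G; case: ifPn => _; first exact: gfin.
  rewrite (integral_normal_indic (mA i)).
  by rewrite -ge0_fin_numE//; apply: fin_num_measure; exact: mA.
suff H k : (k <= d)%N -> forall A, (forall i, measurable (A i)) ->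
  (\int[P]_t (\prod_(i < d) G k A i (tnth t i))%:E =
   \prod_(i < d) \int[gamma]_x (G k A i x)%:E)%E.
  have := H d (leqnn d) (fun=> setT) (fun=> measurableT).
  rewrite /G; under eq_integral do under eq_bigr do rewrite ltn_ord.
  by under [in X in _ = X -> _]eq_bigr do under eq_integral do rewrite ltn_ord.
elim: k => [_ A mA|k IH kd A mA].
  rewrite /G /=; rewrite [RHS](eq_bigr (fun i => gamma (A i))); last first.
    by move=> i _; exact: integral_normal_indic (mA i).
  rewrite -hP//.
  rewrite (_ : (fun _ => _) = (fun t => (\1_[set t | forall i, A i (tnth t i)] t)%:E)).
    rewrite integral_indic// ?setIT//; apply: measurable_forall_ord => i.
    by rewrite -[X in measurable X]setTI; exact: measurable_tnth.
  apply/funext => t; congr EFin; rewrite indicE.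
  have [At|] := pselect (forall i, A i (tnth t i)).
    by rewrite mem_set// big1// => i _; rewrite indicE mem_set.
  move=> /[dup] nAt /existsNP[i nAi]; rewrite memNset// (bigD1 i)//= indicE memNset//.
  by rewrite mul0r.
pose o : 'I_d := Ordinal kd.
pose W (t : d.-tuple R) := \prod_(i < d | i != o) G k A i (tnth t i).
pose c := (\prod_(i < d | i != o) \int[gamma]_x (G k A i x)%:E)%E.
have c0 : (0 <= c)%E.
  by apply: prode_ge0 => i _; apply: integral_ge0 => x _; rewrite lee_fin.
have cfin : c \is a fin_num by apply: prode_fin_num => i _; exact: Gfin.
have W0 t : 0 <= W t by rewrite prodr_ge0.
have mW : measurable_fun setT W.
  rewrite /W; under eq_fun do rewrite big_mkcond/=.
  apply: measurable_prod => i _; case: (i != o) => //.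
  by apply: measurableT_comp; [exact: mG|exact: measurable_tnth].
have GS i : G k.+1 A i = if i == o then g o else G k A i.
  rewrite /G; have [->|io] := eqVneq i o; first by rewrite /= ltnSn.
  rewrite ltnS leq_eqVlt; have [ik|//] := eqVneq (i : nat) k.
  by move: io; rewrite -val_eqE/= ik eqxx.
pose nu := density P mW W0.
have mpr : measurable_fun setT (fun t : d.-tuple R => tnth t o : measurableTypeR R).
  exact: measurable_tnth.
pose pr : {mfun d.-tuple R >-> measurableTypeR R} :=
  HB.pack (fun t : d.-tuple R => tnth t o : measurableTypeR R)
    (isMeasurableFun.Build _ _ _ _ _ mpr).
(* The other factors form a weight W. The induction hypothesis with an arbitrary B as k-th set says
   that coordinate k, under W P, is distributed as c times gamma; hence g k can be integrated in
   place of an indicator. *)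
have nuE B : measurable B -> pushforward nu pr B = mscale (NngNum (fine_ge0 c0)) gamma B.
  move=> mB; pose A' (i : 'I_d) : set R := if i == o then B else A i.
  have mA' i : measurable (A' i).
    by rewrite /A'; case: (i == o); [exact: mB|exact: mA].
  have GA' i : G k A' i = if i == o then (\1_B : R -> R) else G k A i.
    rewrite /G /A'; have [->|//] := eqVneq i o.
    by rewrite /= ltnn.
  have := IH (ltnW kd) A' mA'.
  rewrite [in X in _ = X -> _](bigD1 o)//= GA' eqxx integral_normal_indic//.
  rewrite (eq_bigr (fun i => \int[gamma]_x (G k A i x)%:E)%E); last first.
    by move=> i io; rewrite GA' (negPf io).
  rewrite -/c /mscale/= fineK// muleC => <-.
  rewrite /pushforward/= /nu /density [LHS]integral_mkcond; apply: eq_integral => t _.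
  rewrite patchE (bigD1 o)//= GA' eqxx indicE.
  rewrite (eq_bigr (fun i => G k A i (tnth t i))); last first.
    by move=> i io; rewrite GA' (negPf io).
  have [tB|tB] := pselect (B (tnth t o)); first by rewrite !mem_set// mul1r.
  by rewrite !memNset// mul0r.
transitivity (\int[pushforward nu pr]_x (g o x)%:E)%E.
  rewrite ge0_integral_pushforward//; last 2 first.
  - by apply/measurable_EFinP; exact: mg.
  - by move=> x _; rewrite lee_fin.
  rewrite preimage_setT integral_density; last 2 first.
  - by apply/measurable_EFinP; apply: measurableT_comp; [exact: mg|exact: measurable_tnth].
  - by move=> t; rewrite lee_fin.
  apply: eq_integral => t _; rewrite (bigD1 o)//= GS eqxx EFinM; congr (_ * _%:E)%E.
  by apply: eq_bigr => i io; rewrite GS (negPf io).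
transitivity (\int[mscale (NngNum (fine_ge0 c0)) gamma]_x (g o x)%:E)%E.
  by apply: eq_measure_integral => B mB _; exact: nuE.
have mgE : measurable_fun setT (fun x : measurableTypeR R => (g o x)%:E).
  by apply/measurable_EFinP; exact: mg.
rewrite (ge0_integral_mscale _ measurableT _ mgE); last by move=> x _; rewrite lee_fin.
rewrite /= fineK// muleC (bigD1 o)//= GS eqxx; congr (_ * _)%E.
by apply: eq_bigr => i io; rewrite GS (negPf io).
Qed.

Definition tshift (h : 'rV[R]_d) (t : d.-tuple R) : d.-tuple R :=
  [tuple tnth t i + h 0 i | i < d].

Lemma rv_tshift (h : 'rV[R]_d) t : rv (tshift h t) = rv t + h.
Proof. by apply/rowP => i; rewrite !mxE tnth_mktuple. Qed.

Lemma measurable_tshift (h : 'rV[R]_d) : measurable_fun setT (tshift h).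
Proof.
apply/measurable_fun_tnthP => i.
rewrite (_ : _ \o _ = fun t => tnth t i + h 0 i); last first.
  by apply/funext => t /=; rewrite tnth_mktuple.
by apply: measurable_funD => //; exact: measurable_tnth.
Qed.

Lemma measurable_rv (i : 'I_d) : measurable_fun setT (fun t : d.-tuple R => rv t 0 i).
Proof.
by rewrite (_ : (fun _ => _) = @tnth d R ^~ i);
  [exact: measurable_tnth|apply/funext => t; rewrite mxE].
Qed.

(** The density of N(h, I) relative to N(0, I), kept as a product to fit [std_gaussian_prod]; the
    closed form is [girsanovE]. *)
Definition girsanov (h : 'rV[R]_d) (t : d.-tuple R) : R :=
  \prod_(i < d) expR (h 0 i * tnth t i - h 0 i ^+ 2 / 2).

Lemma girsanov_ge0 h t : 0 <= girsanov h t.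
Proof. by apply: prodr_ge0 => i _; exact: expR_ge0. Qed.

Lemma measurable_girsanov h : measurable_fun setT (girsanov h).
Proof.
apply: measurable_prod => i _; apply: measurableT_comp => //.
apply: measurable_funB => //; apply: measurable_funM => //.
exact: measurable_tnth.
Qed.

Lemma girsanov_orthant h a :
  (P (tshift h @^-1` orthant a) = \int[P]_(t in orthant a) (girsanov h t)%:E)%E.
Proof.
rewrite (_ : _ @^-1` _ = [set t | forall i, `]-oo, (a i - h 0 i)[%classic (tnth t i)]).
  rewrite [LHS](hP (fun i => measurable_itv `]-oo, (a i - h 0 i)[)).
  under eq_bigr do rewrite normal_prob_shift.
  rewrite -std_gaussian_prod.
  - rewrite [RHS]integral_mkcond; apply: eq_integral => t _; rewrite patchE.
    have [ta|] := pselect (orthant a t).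
      rewrite mem_set//; congr EFin; apply: eq_bigr => i _.
      by rewrite indicE mem_set ?mulr1//= in_itv/= ta.
    move=> /[dup] nta /existsNP[i /= ai]; rewrite memNset// (bigD1 i)//= indicE.
    by rewrite memNset ?mulr0 ?mul0r//= in_itv/=.
  - move=> i; apply: measurable_funM; last exact: measurable_indic.
    by apply: measurableT_comp => //; exact: measurable_funB.
  - by move=> i x; rewrite mulr_ge0// expR_ge0.
  - move=> i; rewrite -normal_prob_shift -ge0_fin_numE//; apply: fin_num_measure.
    exact: measurable_itv.
by apply/seteqP; split => t /= ta i; have := ta i; rewrite tnth_mktuple in_itv/= ltrBrDr.
Qed.

Lemma girsanov_prob h (A : set (d.-tuple R)) : measurable A ->
  (P (tshift h @^-1` A) = \int[P]_(t in A) (girsanov h t)%:E)%E.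
Proof.
pose H : {mfun d.-tuple R >-> d.-tuple R} := HB.pack (tshift h)
  (isMeasurableFun.Build _ _ _ _ _ (measurable_tshift h)).
apply: (@tuple_measure_unique _ _ (pushforward P H)
  (density P (measurable_girsanov h) (girsanov_ge0 h))); last exact: girsanov_orthant.
by rewrite /= /pushforward preimage_setT probability_setT ltry.
Qed.

Lemma girsanov_integral h (g : d.-tuple R -> \bar R) : measurable_fun setT g ->
  (forall t, (0 <= g t)%E) ->
  (\int[P]_t g (tshift h t) = \int[P]_t (g t * (girsanov h t)%:E))%E.
Proof.
move=> mg g0; pose H : {mfun d.-tuple R >-> d.-tuple R} := HB.pack (tshift h)
  (isMeasurableFun.Build _ _ _ _ _ (measurable_tshift h)).
transitivity (\int[pushforward P H]_t g t)%E.
  by rewrite ge0_integral_pushforward// preimage_setT.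
rewrite -(integral_density _ (measurable_girsanov h) (girsanov_ge0 h))//.
by apply: eq_measure_integral => A mA _; exact: girsanov_prob.
Qed.

(** The one exponential moment behind integrability of exp(a |u|), the moment bound and the Chernoff
    bound. *)
Lemma gaussian_mgf_sqr (l : R) : l < 2^-1 ->
  (\int[P]_t (expR (l * enorm (rv t) ^+ 2))%:E =
   ((Num.sqrt (1 - 2 * l))^-1 ^+ d)%:E)%E.
Proof.
move=> l2.
transitivity (\int[P]_t (\prod_(i < d) expR (l * tnth t i ^+ 2))%:E)%E.
  apply: eq_integral => t _; congr EFin; rewrite -expR_sum sqr_enorm mulr_sumr.
  by congr expR; apply: eq_bigr => i _; rewrite mxE.
rewrite (@std_gaussian_prod (fun _ x => expR (l * x ^+ 2))).
- by under eq_bigr do rewrite normal_mgf_sqr//; rewrite prodEFin prodr_const card_ord.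
- move=> i; by apply: measurableT_comp => //; exact: measurable_funM.
- by move=> i x; exact: expR_ge0.
- by move=> i; rewrite normal_mgf_sqr// ltry.
Qed.

End gaussian.

Lemma differentiable_grad_rV (R : realType) (d : nat) (F : 'rV[R]_d -> R)
    (x g : 'rV[R]_d) :
  (forall e : R, 0 < e -> exists2 r : R, 0 < r & forall h : 'rV[R]_d, `|h| < r ->
    `|F (x + h) - F x - inner g h| <= e * `|h|) ->
  differentiable F x /\ grad F x = g.
Proof.
move=> H.
pose df (h : 'rV[R]_d) := inner g h.
have lin : linear df.
  by move=> a u v; rewrite /df innerDr innerZr.
pose dfl : {linear 'rV[R]_d -> R} :=
  HB.pack df (GRing.isLinear.Build _ _ _ _ df lin).
have cdf : continuous dfl.
  move=> u; apply: rV_continuous_at => e e0.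
  pose K := enorm g * d%:R + 1.
  have K0 : 0 < K by rewrite ltr_wpDl// mulr_ge0// enorm_ge0.
  exists (e / K); first by rewrite divr_gt0.
  move=> v; rewrite /= /df ltr_pdivlMr// => vu.
  rewrite -innerNr -innerDr (le_trans (norm_inner_norm _ _))//.
  rewrite (le_trans _ (ltW vu))// mulrA [leRHS]mulrC ler_wpM2r// lerDl.
  exact: ler01.
have near0 (e : R) : 0 < e -> \forall h \near (0 : 'rV[R]_d),
    `|(F \o shift x) h - (cst (F x) + dfl) h| <= e * `|h|.
  move=> e0; have [r r0 rF] := H e e0.
  apply/nbhs_ballP; exists r => //= h; rewrite mx_norm_ball /ball_/= sub0r normrN => hr.
  by have := rF h hr; rewrite !fctE /= /df [x + h]addrC opprD addrA.
have dFE : 'd F x = dfl :> ('rV[R]_d -> R).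
  by apply: diff_unique; [exact: cdf|apply/eqaddoP].
have dF : differentiable F x.
  by apply/diff_locallyP; rewrite dFE; split; [exact: cdf|apply/eqaddoP].
by split=> //; apply/rowP => i; rewrite mxE dFE /= /df inner_delta.
Qed.

(** * Differentiability almost everywhere *)

Section difference_quotients.
Variables (R : realType) (d : nat) (F : 'rV[R]_d -> R).
Implicit Types (u v w : 'rV[R]_d) (n : nat).

(** Only the countably many scales 1/(n+1) occur, so limsups in n are measurable in u. *)
Definition dq v n u : R := n.+1%:R * (F (u + n.+1%:R^-1 *: v) - F u).

(* A junk value where F is not differentiable, but measurable in u everywhere. *)
Definition dgrad u : 'rV[R]_d :=
  \row_(i < d) limn_sup (fun n => dq (delta_mx 0 i) n u).

Definition intv (k : 'I_d -> int) : 'rV[R]_d := \row_i (k i)%:~R.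

Definition dq_linear_at u : Prop := forall k : {ffun 'I_d -> int},
  (fun n => dq (intv k) n u) @ \oo --> inner (dgrad u) (intv k).

Lemma dq_cvg_diff u v : differentiable F u ->
  (fun n => dq v n u) @ \oo --> inner (grad F u) v.
Proof.
move=> dF; rewrite inner_grad -deriveE//.
have := @diff_derivable _ _ _ F u v dF; rewrite /derivable => /cvg_ex[/= l Fl].
rewrite /derive (cvg_lim _ Fl)//.
have /cvgr_dnbhsP/(_ (fun n => n.+1%:R^-1)) := Fl.
have a0 : (forall n, n.+1%:R^-1 != 0 :> R) /\ n.+1%:R^-1 @[n --> \oo] --> (0 : R).
  by split=> [n|]; [rewrite invr_eq0 pnatr_eq0|exact: cvg_harmonic].
move=> /(_ a0); rewrite (_ : (fun n : nat => _) = dq v ^~ u)//.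
by apply/funext => n; rewrite /dq invrK (addrC u).
Qed.

Lemma dgrad_diff u : differentiable F u -> dgrad u = grad F u.
Proof.
move=> dF; apply/rowP => i; rewrite [LHS]mxE -inner_delta.
by have [_ ->] := cvg_limn_inf_sup (dq_cvg_diff (v := delta_mx 0 i) dF).
Qed.

Lemma dq_linear_at_diff u : differentiable F u -> dq_linear_at u.
Proof. by move=> dF k; rewrite dgrad_diff//; exact: dq_cvg_diff. Qed.

(* Along the scale s = 1/(n+1), every increment h is approximated by s k with
   k an integer vector with entries bounded by a fixed N. *)
Lemma diff_dq_linear_at u : locally_lipschitz F -> dq_linear_at u ->
  differentiable F u /\ grad F u = dgrad u.
Proof.
move=> /(_ u)[r [r0 [L0 FL0]]] lin.
apply: differentiable_grad_rV => e e0.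
pose L : R := `|L0| + 1.
have L1 : 0 < L by rewrite ltr_wpDl.
have FL y z : enorm (y - u) < r -> enorm (z - u) < r -> `|F y - F z| <= L * enorm (y - z).
  move=> yu zu; rewrite (le_trans (FL0 _ _ yu zu))// ler_wpM2r ?enorm_ge0//.
  by rewrite (le_trans (ler_norm _))// lerDl.
pose G := dgrad u.
pose M : R := (L + enorm G) * d.+1%:R.
have M0 : 0 < M by rewrite mulr_gt0 ?ltr0n// ltr_pwDl// enorm_ge0.
(* N is the resolution of the grid: M/N <= e/4 makes the rounding error affordable. *)
pose N := (Num.truncn (4 * M / e)).+1.
have N0 : 0 < N%:R :> R by rewrite ltr0n.
have MN : M / N%:R <= e / 4.
  have : 4 * M / e < N%:R by exact: truncnS_gt.
  rewrite ltr_pdivrMr// ler_pdivrMr//; lra.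
(* The integer cube with entries between - N and N, encoded as a finite type so that the convergence
   is uniform over it. *)
pose kv (k : {ffun 'I_d -> 'I_(2 * N).+1}) : {ffun 'I_d -> int} :=
  [ffun i => (k i : nat)%:Z - N%:Z].
have [n0 n0P] : exists n0, forall n (k : {ffun 'I_d -> 'I_(2 * N).+1}),
    (n0 <= n)%N -> `|dq (intv (kv k)) n u - inner G (intv (kv k))| <= e / 8.
  have /choice[m mP] : forall k : {ffun 'I_d -> 'I_(2 * N).+1}, exists m, forall n,
      (m <= n)%N -> `|dq (intv (kv k)) n u - inner G (intv (kv k))| <= e / 8.
    move=> k; have /cvgrPdist_le/(_ (e / 8)) := lin (kv k).
    rewrite divr_gt0// => /(_ isT)[m _ mP]; exists m => n mn.
    by rewrite distrC; exact: mP.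
  exists (\max_k m k) => n k mn; apply: mP; apply: leq_trans mn.
  exact: leq_bigmax.
have d0 : 0 < d.+1%:R :> R by rewrite ltr0n.
(* The three terms respectively force n >= n0, make M |h| at most e/8, and keep u + h and u + s v in
   the Lipschitz ball. *)
exists (Num.min n0.+1%:R^-1 (Num.min (e / (8 * M)) (r / (2 * d.+1%:R)))).
  by rewrite !lt_min invr_gt0 ltr0n !divr_gt0// mulr_gt0.
move=> h; rewrite !lt_min => /and3P[hn0 he hr].
have [->|h0] := eqVneq h 0.
  by rewrite addr0 subrr sub0r normrN (le_trans (norm_inner_norm _ _))// normr0 !mulr0.
set rho := `|h| in hn0 he hr *.
have rho0 : 0 < rho by rewrite normr_gt0.
pose t : R := rho / N%:R.
have t0 : 0 < t by rewrite divr_gt0.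
have trho : t <= rho by rewrite ler_pdivrMr// ler_peMr// ?ler1n// ltW.
have tN : t * N%:R = rho by rewrite divfK// gt_eqF.
have tV : n0.+1%:R < t^-1.
  by rewrite -[ltLHS]invrK ltf_pV2 ?posrE ?invr_gt0 ?ltr0n// (le_lt_trans trho).
(* With n + 1 the integer part of 1/t, the scale s = 1/(n+1) satisfies t <= s and s - t <= s t. *)
pose n := (Num.truncn t^-1).-1.
have nE : n.+1 = Num.truncn t^-1.
  by rewrite prednK// truncn_gt0 (le_trans _ (ltW tV))// ler1n.
have n0n : (n0 <= n)%N.
  by rewrite -ltnS nE truncn_gt_nat ltW.
pose s : R := n.+1%:R^-1.
have s0 : 0 < s by rewrite invr_gt0 ltr0n.
have /andP[sVt tsV] : s^-1 <= t^-1 < s^-1 + 1.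
  by rewrite invrK natr1 nE; apply: truncn_itv; rewrite invr_ge0 ltW.
have ts : t <= s by rewrite -lef_pV2.
have sts : s - t <= s * t.
  have := ler_wpM2l (mulr_ge0 (ltW s0) (ltW t0)) (ltW tsV).
  by rewrite mulfK ?gt_eqF// mulrDr mulr1 mulrAC mulfV ?gt_eqF// mul1r; lra.
have t1 : t <= 1.
  by rewrite -[t]invrK invf_le1 ?invr_gt0// (le_trans _ (ltW tV))// ler1n.
have s2t : s <= 2 * t.
  have s1 : s <= 1 by rewrite invf_le1 ?ltr0n// ler1n.
  have : s * t <= t := ler_piMl (ltW t0) s1.
  lra.
have hi i : `|h 0 i| <= rho by exact: ler_coord_norm.
pose y i := h 0 i / t.
have yN i : `|y i| <= N%:R.
  by rewrite normrM normfV (gtr0_norm t0) ler_pdivrMr// mulrC tN.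
pose z i := Num.floor (y i).
have zN i : - N%:Z <= z i <= N%:Z.
  have := yN i; rewrite ler_norml => /andP[y1 y2].
  rewrite floor_ge_int mulrNz y1/= -ltzD1 floor_lt_int.
  by rewrite (le_lt_trans y2)// intrD ltrDl.
pose k : {ffun 'I_d -> 'I_(2 * N).+1} := [ffun i => inord (absz (z i + N%:Z))].
have kvz : kv k =1 z.
  move=> i; have /andP[z1 z2] := zN i.
  have zN0 : 0 <= z i + N%:Z by rewrite -lerBlDr sub0r.
  rewrite !ffunE inordK; first by rewrite gez0_abs ?addrK.
  by rewrite ltnS -lez_nat gez0_abs// mul2n -addnn PoszD lerD2r.
pose v := intv (kv k).
have vE i : v 0 i = (z i)%:~R by rewrite mxE kvz.
have vN i : `|v 0 i| <= N%:R.
  have /andP[z1 z2] := zN i; rewrite vE ler_norml; apply/andP; split.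
    by rewrite (_ : - N%:R = (- N%:Z)%:~R) ?ler_int// mulrNz.
  by rewrite (_ : N%:R = (N%:Z)%:~R) ?ler_int.
(* Rounding h/t to an integer vector costs t = |h|/N per coordinate; replacing t by s costs at most
   (s - t) N <= s |h|. *)
have hsv : `|h - s *: v| <= rho / N%:R + s * rho.
  apply: ler_norm_rV => [|i]; first exact: addr_ge0 (ltW (divr_gt0 rho0 N0)) (ltW (mulr_gt0 s0 rho0)).
  have -> : (h - s *: v) 0 i = t * (y i - v 0 i) + (t - s) * v 0 i.
    rewrite 3![in LHS]mxE -/(v 0 i) /y mulrBr mulrCA mulfV ?gt_eqF// mulr1; ring.
  rewrite (le_trans (ler_normD _ _))// lerD//.
    rewrite normrM (gtr0_norm t0) -[leRHS]mulr1 ler_wpM2l ?(ltW t0)// vE.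
    have /andP[z1 z2] := floor_itv (y i).
    by rewrite ger0_norm ?subr_ge0//; move: z2; rewrite intrD; lra.
  have st0 : 0 <= s - t by rewrite subr_ge0.
  have := ler_pM st0 (normr_ge0 _) sts (vN i).
  by rewrite -mulrA tN normrM distrC (ger0_norm st0).
have nsv : enorm (s *: v) < r.
  rewrite enormZ (gtr0_norm s0).
  have vle : enorm v <= d.+1%:R * N%:R.
    rewrite (le_trans (ler_enorm_norm _))// ler_pM// ?ler_nat//.
    by apply: ler_norm_rV.
  rewrite (le_lt_trans (ler_wpM2l (ltW s0) vle))//.
  rewrite (@le_lt_trans _ _ (2 * t * (d.+1%:R * N%:R)))//.
    by rewrite ler_wpM2r// mulr_ge0.
  rewrite (_ : _ * _ = rho * (2 * d.+1%:R)); last by rewrite -tN; ring.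
  by rewrite -ltr_pdivlMr// mulr_gt0.
have nh : enorm h < r.
  rewrite (le_lt_trans (ler_enorm_norm _))//.
  rewrite (@le_lt_trans _ _ (rho * (2 * d.+1%:R)))//; last first.
    by rewrite -ltr_pdivlMr// mulr_gt0.
  rewrite mulrC ler_wpM2l ?(ltW rho0)// -natrM ler_nat mul2n -addnn.
  by rewrite (leq_trans (leqnSn d))// leq_addl.
have esv : enorm (h - s *: v) <= d.+1%:R * (rho / N%:R + s * rho).
  by rewrite (le_trans (ler_enorm_norm _))// ler_pM// ler_nat.
(* The outer terms compare h with s v through the Lipschitz constant and through G; the middle one
   is the convergence along v. Together they stay below 3/4 e |h|. *)
rewrite -/G; have -> : F (u + h) - F u - inner G h =
  (F (u + h) - F (u + s *: v)) + s * (dq v n u - inner G v) + inner G (s *: v - h).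
  rewrite /dq -/s innerDr innerNr innerZr mulrBr mulrA mulVf ?pnatr_eq0//.
  by rewrite mul1r; ring.
have b1 : `|F (u + h) - F (u + s *: v)| <= L * enorm (h - s *: v).
  rewrite (le_trans (FL _ _ _ _)) ?(addrC u) ?addrK//.
  by rewrite opprD addrACA subrr addr0.
have b2 : `|s * (dq v n u - inner G v)| <= 2 * t * (e / 8).
  rewrite normrM (gtr0_norm s0) ler_pM// ?(ltW s0)//.
  exact: n0P.
have b3 : `|inner G (s *: v - h)| <= enorm G * enorm (h - s *: v).
  by rewrite enormB norm_inner_le.
rewrite (le_trans (ler_normD _ _))// (le_trans (lerD (ler_normD _ _) (lexx _)))//.
have b13 : (L + enorm G) * enorm (h - s *: v) <= M * (rho / N%:R + s * rho).
  by rewrite /M -mulrA ler_wpM2l// addr_ge0 ?enorm_ge0 ?(ltW L1).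
have b4 : M * (rho / N%:R) <= e / 4 * rho.
  by rewrite mulrCA mulrC ler_wpM2r ?(ltW rho0).
have b5 : M * (s * rho) <= e / 4 * rho.
  rewrite mulrA ler_wpM2r ?(ltW rho0)//.
  have : rho * (8 * M) < e by rewrite -ltr_pdivlMr// mulr_gt0.
  have : M * s <= M * (2 * t) by rewrite ler_wpM2l ?(ltW M0).
  have : M * t <= M * rho by rewrite ler_wpM2l ?(ltW M0).
  lra.
have b6 : 2 * t * (e / 8) <= e / 4 * rho.
  have : t * e <= rho * e by rewrite ler_wpM2r ?(ltW e0).
  lra.
have e0r : 0 < e * rho by rewrite mulr_gt0.
lra.
Qed.

End difference_quotients.

Lemma enorm_continuous (R : realType) (d : nat) : continuous (@enorm R d).
Proof.
apply: locally_lipschitz_continuous => x; exists 1; split => //; exists 1.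
move=> y z _ _; rewrite mul1r ler_norml.
have := enormD (y - z) z; have := enormD (z - y) y.
by rewrite !subrK (enormB z); lra.
Qed.

Lemma measurable_cvg_set (d : measure_display) (T : measurableType d) (R : realType)
  (h : nat -> T -> R) (l : T -> R) :
  (forall n, measurable_fun setT (h n)) -> measurable_fun setT l ->
  measurable [set t | h ^~ t @ \oo --> l t].
Proof.
move=> mh ml.
rewrite [X in measurable X](_ : _ = \bigcap_k \bigcup_N \bigcap_(n >= N)
  [set t | `|l t - h n t| <= k.+1%:R^-1]).
  apply: bigcap_measurable => [|k _]; first by exists 0%N.
  apply: bigcup_measurable => N _.
  apply: bigcap_measurable => [|n _]; first by exists N => /=.
  rewrite [X in measurable X](_ : _ =
    (fun t => `|l t - h n t|) @^-1` `]-oo, k.+1%:R^-1]); last first.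
    by apply/seteqP; split => t /=; rewrite in_itv.
  rewrite -[X in measurable X]setTI.
  have : measurable_fun setT (fun t => `|l t - h n t|).
    by apply: measurableT_comp => //; exact: measurable_funB.
  by apply => //; exact: measurable_itv.
apply/seteqP; split => t /=.
  move=> /cvgrPdist_le hl k _.
  by have [|N _ NP] := hl k.+1%:R^-1; [rewrite invr_gt0|exists N].
move=> H; apply/cvgrPdist_le => e e0.
have [k ke] : exists k : nat, k.+1%:R^-1 <= e.
  exists (Num.truncn e^-1); rewrite -[leRHS]invrK lef_pV2 ?posrE ?invr_gt0 ?ltr0n//.
  exact: ltW (truncnS_gt _).
have [N _ NP] := H k I; exists N => // n /= Nn; apply: le_trans ke.
exact: NP.
Qed.

Section exp_lipschitz.
Variables (R : realType) (d : nat).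
Implicit Types (F : 'rV[R]_d -> R) (C c : R).

(** Coarser than the polynomial bound, but stable under u |-> x + sigma u, and it bounds the
    quotients by Gaussian-integrable functions b exp(a |u|). *)
Definition exp_lipschitz F C c := [/\ 0 <= C, 0 <= c & forall y z,
  `|F y - F z| <= C * expR (c * (enorm y + enorm z)) * enorm (y - z)].

Lemma exp_lipschitz_locally F C c : exp_lipschitz F C c -> locally_lipschitz F.
Proof.
move=> [C0 c0 FC] x; exists 1; split=> //.
exists (C * expR (c * (2 * (enorm x + 1)))) => y z yx zx.
have near_x w : enorm (w - x) < 1 -> enorm w <= enorm x + 1.
  move=> wx; rewrite -[w](subrK x) addrC (le_trans (enormD _ _))// lerD2l.
  exact: ltW.
rewrite (le_trans (FC y z))// ler_wpM2r ?enorm_ge0// ler_wpM2l// ler_expR.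
rewrite ler_wpM2l//; have := near_x _ yx; have := near_x _ zx; lra.
Qed.

Lemma dq_bound F C c v n u : exp_lipschitz F C c ->
  `|dq F v n u| <= C * expR (c * (2 * enorm u + enorm v)) * enorm v.
Proof.
move=> [C0 c0 FC]; have n0 : 0 < n.+1%:R :> R by rewrite ltr0n.
have n1 : n.+1%:R^-1 <= 1 :> R by rewrite invf_le1// ler1n.
rewrite normrM (gtr0_norm n0) -ler_pdivlMl// (le_trans (FC _ _))//.
rewrite [u + _ in X in _ * X]addrC addrK enormZ gtr0_norm ?invr_gt0// mulrCA.
rewrite ler_wpM2l ?invr_ge0// ler_wpM2r ?enorm_ge0// ler_wpM2l// ler_expR.
rewrite ler_wpM2l//.
have := enormD u (n.+1%:R^-1 *: v); rewrite enormZ gtr0_norm ?invr_gt0//.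
have : n.+1%:R^-1 * enorm v <= enorm v by rewrite ler_piMl// enorm_ge0.
by move: (enorm (u + _)) (_ * enorm v) => a b; lra.
Qed.

Lemma bounded_dq F C c v u : exp_lipschitz F C c ->
  has_ubound (range (fun n => dq F v n u)) /\ has_lbound (range (fun n => dq F v n u)).
Proof.
move=> /dq_bound FC; have {}FC n := FC v n u.
split; [exists (C * expR (c * (2 * enorm u + enorm v)) * enorm v)|
        exists (- (C * expR (c * (2 * enorm u + enorm v)) * enorm v))].
  by move=> _ [n _ <-]; rewrite (le_trans (ler_norm _)).
by move=> _ [n _ <-]; have := FC n; rewrite ler_norml => /andP[].
Qed.

Section measurability.
Variables (d' : measure_display) (T : measurableType d') (phi : T -> 'rV[R]_d).
Hypothesis mphi : forall i, measurable_fun setT (fun t => phi t 0 i).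
Variables (F : 'rV[R]_d -> R) (C c : R).
Hypothesis FC : exp_lipschitz F C c.

Let cF : continuous F.
Proof. exact: locally_lipschitz_continuous (exp_lipschitz_locally FC). Qed.

Lemma measurable_dq v n : measurable_fun setT (fun t => dq F v n (phi t)).
Proof.
apply: measurable_funM => //; apply: measurable_funB; last first.
  exact: measurable_continuous_rV.
apply: (@measurable_continuous_rV _ _ _ _ (fun t => phi t + n.+1%:R^-1 *: v)) => // i.
under eq_fun do rewrite mxE.
by apply: measurable_funD => //; exact: mphi.
Qed.

Lemma measurable_limsup_dq v :
  measurable_fun setT (fun t => limn_sup (fun n => dq F v n (phi t))).
Proof.
apply: (@measurable_fun_limn_sup _ _ _ setT (fun n t => dq F v n (phi t))).
- by move=> t _; exact: (bounded_dq _ _ FC).1.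
- by move=> t _; exact: (bounded_dq _ _ FC).2.
- by move=> n; exact: measurable_dq.
Qed.

Lemma measurable_dgrad i : measurable_fun setT (fun t => dgrad F (phi t) 0 i).
Proof.
rewrite (_ : (fun _ => _) =
  fun t => limn_sup (fun n => dq F (delta_mx 0 i) n (phi t))).
  exact: measurable_limsup_dq.
by apply/funext => t; rewrite mxE.
Qed.

Lemma measurable_inner_dgrad v : measurable_fun setT (fun t => inner (dgrad F (phi t)) v).
Proof.
apply: measurable_sum => i; apply: measurable_funM => //.
exact: measurable_dgrad.
Qed.

Lemma measurable_cvg_dq v : measurable [set t | cvgn (fun n => dq F v n (phi t))].
Proof.
rewrite [X in measurable X](_ : _ =
  [set t | (fun n => dq F v n (phi t)) @ \oo --> limn_sup (fun n => dq F v n (phi t))]).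
  apply: measurable_cvg_set; last exact: measurable_limsup_dq.
  by move=> n; exact: measurable_dq.
apply/seteqP; split => t /= H; first by rewrite cvg_limn_supE.
by apply/cvg_ex; eexists; exact: H.
Qed.

(** Differentiability is equivalent to convergence of the quotients to a linear limit along the
    countably many integer vectors. *)
Lemma measurable_differentiable : measurable [set t | differentiable F (phi t)].
Proof.
rewrite [X in measurable X](_ : _ = \bigcap_(k in [set: {ffun 'I_d -> int}])
  [set t | (fun n => dq F (intv R k) n (phi t)) @ \oo -->
           inner (dgrad F (phi t)) (intv R k)]).
  rewrite -[X in measurable X]setCK setC_bigcap; apply: measurableC.
  apply: countable_bigcupT_measurable => [|k]; first exact: countableP.
  apply: measurableC; apply: measurable_cvg_set; last exact: measurable_inner_dgrad.
  by move=> n; exact: measurable_dq.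
apply/seteqP; split => t /= H.
  by move=> k _; exact: dq_linear_at_diff.
have /(diff_dq_linear_at (exp_lipschitz_locally FC))[] // : dq_linear_at F (phi t).
by move=> k; exact: H.
Qed.

End measurability.

End exp_lipschitz.

Section gaussian_integrability.
Variables (R : realType) (d : nat) (P : probability (d.-tuple R) R).
Hypothesis hP : std_gaussian P.

Lemma measurable_enorm_rv : measurable_fun setT (fun t : d.-tuple R => enorm (rv t)).
Proof. exact: measurable_continuous_rV (@measurable_rv _ _) (@enorm_continuous _ _). Qed.

(** Because a r <= a^2 + r^2/4, and exp(|u|^2/4) has finite mean. *)
Lemma integrable_exp_enorm (b a : R) :
  P.-integrable setT (fun t => (b * expR (a * enorm (rv t)))%:E).
Proof.
have i1 : P.-integrable setT (fun t => (expR (4^-1 * enorm (rv t) ^+ 2))%:E).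
  apply/integrableP; split.
    apply/measurable_EFinP; apply: measurableT_comp => //.
    apply: measurable_funM => //; apply: measurable_funX.
    exact: measurable_enorm_rv.
  under eq_integral do rewrite /= ger0_norm ?expR_ge0//.
  by rewrite gaussian_mgf_sqr ?ltry//; lra.
apply: (@le_integrable _ _ _ P setT measurableT _
  (fun t => ((`|b| * expR (a ^+ 2))%:E * (expR (4^-1 * enorm (rv t) ^+ 2))%:E)%E)).
- apply/measurable_EFinP; apply: measurable_funM => //; apply: measurableT_comp => //.
  by apply: measurable_funM => //; exact: measurable_enorm_rv.
- move=> t _; rewrite /= lee_fin !normrM normr_id !(@ger0_norm _ (expR _)) ?expR_ge0//.
  rewrite -mulrA ler_wpM2l// -expRD ler_expR.
  by have := sqr_ge0 (a - 2^-1 * enorm (rv t)); rewrite sqrrB; lra.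
- exact: integrableZl.
Qed.

End gaussian_integrability.

Section rademacher.
Variables (R : realType) (d : nat) (P : probability (d.-tuple R) R).
Hypothesis hP : std_gaussian P.
Variables (F : 'rV[R]_d -> R) (C c : R).
Hypothesis FC : exp_lipschitz F C c.
Local Notation mu := (@lebesgue_measure R).

Lemma dq_cvg_line (u v : 'rV[R]_d) :
  {ae mu, forall s, 0 < s < 1 -> cvgn (fun n => dq F v n (u + s *: v))}.
Proof.
have [C0 c0 FCl] := FC.
(* Clamping the parameter makes g globally Lipschitz. The upper end is 2 because s + 1/(n+1) can
   reach beyond 1 but not beyond 2. *)
pose cl (s : R) : R := if s <= 0 then 0 else if 2 <= s then 2 else s.
have cl02 s : 0 <= cl s <= 2.
  by rewrite /cl; case: (leP s 0) => ?; case: (leP 2 s) => ?; lra.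
have cl_mono s t : s <= t -> 0 <= cl t - cl s <= t - s.
  move=> st; rewrite /cl; case: (leP s 0) => ?; case: (leP t 0) => ?;
  by case: (leP 2 s) => ?; case: (leP 2 t) => ?; lra.
have cl_lip s t : `|cl s - cl t| <= `|s - t|.
  wlog st : s t / s <= t => [H|].
    by have [/H//|/ltW /H] := leP s t; rewrite distrC (distrC t).
  have /andP[h1 h2] := cl_mono _ _ st.
  by rewrite distrC (distrC s) (ger0_norm h1) ger0_norm ?subr_ge0.
pose g s := F (u + cl s *: v).
pose L := C * expR (c * (2 * (enorm u + 2 * enorm v))) * enorm v.
have gL s t : `|g s - g t| <= L * `|s - t|.
  have bnd r : enorm (u + cl r *: v) <= enorm u + 2 * enorm v.
    have /andP[r0 r2] := cl02 r.
    rewrite (le_trans (enormD _ _))// lerD2l enormZ ger0_norm//.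
    by rewrite ler_wpM2r// enorm_ge0.
  rewrite (le_trans (FCl _ _))// /L -!mulrA ler_wpM2l//.
  apply: ler_pM; rewrite ?expR_ge0 ?enorm_ge0//.
    rewrite ler_expR ler_wpM2l//; have := bnd s; have := bnd t; lra.
  rewrite opprD addrACA subrr add0r -scalerBl enormZ mulrC ler_wpM2l ?enorm_ge0//.
have := lipschitz_ae_derivable 0 1 gL.
apply: filterS; first exact: (ae_filter_ringOfSetsType mu).
move=> s H /[dup] s01 /H; rewrite /derivable => /cvg_ex[/= l gl].
have /cvgr_dnbhsP/(_ (fun n => n.+1%:R^-1)) := gl.
have a0 : (forall n, n.+1%:R^-1 != 0 :> R) /\ n.+1%:R^-1 @[n --> \oo] --> (0 : R).
  by split=> [n|]; [rewrite invr_eq0 pnatr_eq0|exact: cvg_harmonic].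
move=> /(_ a0) gnl; apply/cvg_ex; exists l.
rewrite (_ : (fun n : nat => _) =
  (fun n => n.+1%:R^-1^-1 *: (g (n.+1%:R^-1 *: 1 + s) - g s)))//.
have /andP[s0 s1] := s01.
have clE r : 0 <= r <= 2 -> cl r = r.
  by rewrite /cl; case: (leP r 0) => ?; case: (leP 2 r) => ? ?; lra.
apply/funext => n; rewrite /dq invrK /g.
have n1 : n.+1%:R^-1 <= 1 :> R by rewrite invf_le1 ?ltr0n// ler1n.
have n0 : 0 <= n.+1%:R^-1 :> R by rewrite invr_ge0.
rewrite !clE; last 2 first.
- lra.
- by rewrite [_ *: _]mulr1; move: n0 n1; move: (n.+1%:R^-1) => q *; lra.
by rewrite [_ *: 1]mulr1 scalerDl addrA addrAC.
Qed.

(* Fubini provides s in ]0, 1[ with almost sure convergence at u + s v, and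
   quasi-invariance transfers it to u. *)
Lemma dq_ae_cvg (v : 'rV[R]_d) :
  P [set t | ~ cvgn (fun n => dq F v n (rv t))] = 0%E.
Proof.
pose B w := [set t : d.-tuple R | ~ cvgn (fun n => dq F v n (rv t + w))].
have mB w : measurable (B w).
  apply: measurableC; apply: (measurable_cvg_dq _ FC) => i.
  by under eq_fun do rewrite mxE; apply: measurable_funD => //; exact: measurable_rv.
pose A : set (d.-tuple R * measurableTypeR R) :=
  [set p | 0 < p.2 < 1 /\ ~ cvgn (fun n => dq F v n (rv p.1 + p.2 *: v))].
have mA : measurable A.
  apply: measurableI.
    rewrite [X in measurable X](_ : _ = snd @^-1` (`]0, 1[%classic : set (measurableTypeR R))).
      rewrite -[X in measurable X]setTI; exact: measurable_snd.
    by apply/seteqP; split => p /=; rewrite in_itv.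
  apply: measurableC; apply: (measurable_cvg_dq _ FC) => i.
  under eq_fun do rewrite !mxE.
  apply: measurable_funD.
    exact: (measurableT_comp (measurable_tnth i) measurable_fst).
  by apply: measurable_funM => //; exact: measurable_snd.
have xA t : mu (xsection A t) = 0%E.
  apply: measure_negligible; first exact: measurable_xsection.
  apply: negligibleS (dq_cvg_line (rv t) v) => s.
  by rewrite /xsection /= inE/= => -[s01 nc] /(_ s01).
have := indic_fubini_tonelli P mu mA.
rewrite indic_fubini_tonelli_FE// indic_fubini_tonelli_GE//.
rewrite (eq_integral (cst 0%E)); last by move=> t _ /=; rewrite xA.
rewrite integral0 => /esym yA.
have [s /andP[s0 s1] Bs] : exists2 s, 0 < s < 1 & P (B (s *: v)) = 0%E.
  apply: contrapT => nex.
  have mf : measurable_fun setT (P \o ysection A) by exact: measurable_fun_ysection.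
  have /(ae_eq_integral_abs mu measurableT mf).1 ae0 :
      (\int[mu]_s `|(P \o ysection A) s| = 0)%E.
    by rewrite -yA; apply: eq_integral => s _; rewrite gee0_abs.
  have : mu (`]0, 1[%classic : set (measurableTypeR R)) = 0%E.
    apply: measure_negligible; first exact: measurable_itv.
    apply: negligibleS ae0 => s /=; rewrite in_itv/= => s01 /(_ I) Ps0.
    apply: nex; exists s => //; rewrite -Ps0 /=; congr (P _).
    by apply/seteqP; split => t; rewrite /ysection/= inE/=; [split|case].
  rewrite lebesgue_measure_itv/= lte_fin ltr01 -EFinB subr0 => /eqP.
  by rewrite onee_eq0.
have := girsanov_prob hP (- (s *: v)) (mB (s *: v)).
rewrite null_set_integral//; last first.
  by apply/measurable_EFinP/measurable_funTS; exact: measurable_girsanov.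
congr (P _ = _); apply/seteqP; split => t; rewrite /B/= rv_tshift ?subrK//.
Qed.

End rademacher.

Lemma Rdominated_convergence (d : measure_display) (T : measurableType d) (R : realType)
  (mu : {measure set T -> \bar R}) (f_ : nat -> T -> R) (f g : T -> R) :
  (forall n, measurable_fun setT (f_ n)) -> measurable_fun setT f ->
  {ae mu, forall t, f_ ^~ t @ \oo --> f t} -> mu.-integrable setT (EFin \o g) ->
  (forall n t, `|f_ n t| <= g t) ->
  mu.-integrable setT (EFin \o f) /\
  (\int[mu]_t f_ n t)%R @[n --> \oo] --> (\int[mu]_t f t)%R.
Proof.
move=> mf_ mf cvgf ig f_g.
have mEf_ n : measurable_fun setT (EFin \o f_ n) by exact/measurable_EFinP.
have mEf : measurable_fun setT (EFin \o f) by exact/measurable_EFinP.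
have cvgEf : {ae mu, forall t, setT t -> (EFin \o f_ n) t @[n --> \oo] --> (EFin \o f) t}.
  by apply: filterS cvgf => t ft _; apply: cvg_EFin; [exact: nearW|exact: ft].
have domf : {ae mu, forall t n, setT t -> (`|(EFin \o f_ n) t| <= (EFin \o g) t)%E}.
  by apply: aeW => t n _; rewrite /= lee_fin.
have [intf _ H] := dominated_convergence measurableT mEf_ mEf cvgEf ig domf.
split=> //; rewrite /Rintegral; apply: fine_cvg; rewrite fineK//.
exact: integrable_fin_num.
Qed.

(** * Translations and orthants under the Gaussian measure *)

Section gaussian_translation.
Variables (R : realType) (d : nat) (P : probability (d.-tuple R) R).
Hypothesis hP : std_gaussian P.

Lemma girsanovE (h : 'rV[R]_d) t :
  girsanov h t = expR (inner h (rv t) - enorm h ^+ 2 / 2).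
Proof.
rewrite /girsanov -expR_sum sqr_enorm mulr_suml /inner -sumrB; congr expR.
by apply: eq_bigr => i _; rewrite mxE.
Qed.

Lemma girsanov_le (h : 'rV[R]_d) t : girsanov h t <= expR (enorm h * enorm (rv t)).
Proof.
rewrite girsanovE ler_expR; have := inner_le h (rv t).
by have := sqr_ge0 (enorm h); lra.
Qed.

Lemma girsanov_cvg (w : 'rV[R]_d) t :
  girsanov (n.+1%:R^-1 *: w) t @[n --> \oo] --> (1 : R).
Proof.
have -> : (fun n => girsanov (n.+1%:R^-1 *: w) t) = (fun n : nat =>
    expR (n.+1%:R^-1 * inner w (rv t) - n.+1%:R^-1 * (n.+1%:R^-1 * (enorm w ^+ 2 / 2)))).
  apply/funext => n; rewrite girsanovE innerZl enormZ ger0_norm//.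
  by rewrite exprMn expr2 !mulrA.
have a0 : n.+1%:R^-1 * inner w (rv t) - n.+1%:R^-1 * (n.+1%:R^-1 * (enorm w ^+ 2 / 2))
    @[n --> \oo] --> (0 * inner w (rv t) - 0 * (0 * (enorm w ^+ 2 / 2)) : R).
  apply: cvgB; first by apply: cvgMl; exact: cvg_harmonic.
  by apply: cvgM; [|apply: cvgMl]; exact: cvg_harmonic.
have := cvg_comp _ _ a0 (@continuous_expR R _).
by rewrite !mul0r subr0 expR0.
Qed.

Lemma girsanov_integral_real (h : 'rV[R]_d) (g : d.-tuple R -> R) :
  measurable_fun setT g ->
  (\int[P]_t g (tshift h t) = \int[P]_t (g t * girsanov h t))%R.
Proof.
move=> mg; rewrite /Rintegral; congr fine; rewrite integralE [RHS]integralE.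
have mEg : measurable_fun setT (EFin \o g) by exact/measurable_EFinP.
congr (_ - _)%E.
- transitivity (\int[P]_t (EFin \o g)^\+%E (tshift h t))%E.
    by apply: eq_integral => t _; rewrite !funeposE.
  rewrite (girsanov_integral hP h (measurable_funepos mEg))//.
  apply: eq_integral => t _; rewrite !funeposE/= -!EFin_max -EFinM.
  by rewrite maxr_pMl ?girsanov_ge0// mul0r.
- transitivity (\int[P]_t (EFin \o g)^\-%E (tshift h t))%E.
    by apply: eq_integral => t _; rewrite !funenegE.
  rewrite (girsanov_integral hP h (measurable_funeneg mEg))//.
  apply: eq_integral => t _; rewrite !funenegE/= -!EFin_max -EFinM.
  by rewrite maxr_pMl ?girsanov_ge0// mul0r mulNr.
Qed.

Lemma coord_ae_neq (i : 'I_d) (a : R) : P [set t | tnth t i = a] = 0%E.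
Proof.
pose A (j : 'I_d) : set R := if j == i then [set a] else setT.
have mA j : measurable (A j) by rewrite /A; case: (j == i).
have := hP mA; rewrite (bigD1 i)//= {2}/A eqxx.
rewrite {1}/normal_prob integral_set1 mul0e => <-; congr (P _).
apply/seteqP; split => t /=; first by move=> ta j; rewrite /A; case: eqVneq => [->|].
by move=> /(_ i); rewrite /A eqxx.
Qed.

(** The measures with densities f^+ and f^- are finite and agree on orthants, hence everywhere; so f
    has integral 0 over every measurable set. *)
Lemma orthant_ae_eq0 (f : d.-tuple R -> R) : P.-integrable setT (EFin \o f) ->
  (forall a, (\int[P]_(t in orthant a) (f t)%:E = 0)%E) ->
  {ae P, forall t, f t = 0}.
Proof.
move=> intf f0; have mf : measurable_fun setT f.
  by apply/measurable_EFinP; exact: measurable_int intf.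
have mfp : measurable_fun setT (f^\+)%R by exact: measurable_funrpos.
have mfn : measurable_fun setT (f^\-)%R by exact: measurable_funrneg.
pose m1 := density P mfp (funrpos_ge0 f).
pose m2 := density P mfn (funrneg_ge0 f).
have intE A : measurable A -> (\int[P]_(t in A) (f t)%:E = m1 A - m2 A)%E.
  move=> mA; rewrite integralE -[fun t => (f t)%:E]/(EFin \o f).
  by rewrite funerpos funerneg.
have m_fin A : measurable A -> (m1 A \is a fin_num) && (m2 A \is a fin_num).
  move=> mA; apply/andP; split.
    have := integrable_fin_num mA (integrableS measurableT mA (@subsetT _ _) (integrable_funepos measurableT intf)).
    by rewrite funerpos.
  have := integrable_fin_num mA (integrableS measurableT mA (@subsetT _ _) (integrable_funeneg measurableT intf)).
  by rewrite funerneg.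
have m12 A : measurable A -> m1 A = m2 A.
  apply: tuple_measure_unique.
    by have /andP[+ _] := m_fin _ measurableT; rewrite ge0_fin_numE.
  move=> a; have := f0 a; rewrite intE; last exact: measurable_orthant.
  have /andP[f1 f2] := m_fin _ (measurable_orthant a).
  by move=> /eqP; rewrite sube_eq ?f2// ?add0e ?fin_num_adde_defl// => /eqP.
have : ae_eq P setT (EFin \o f) (cst 0%E).
  apply: integral_ae_eq => //.
  move=> E _ mE; rewrite intE// m12// integral0 subee//.
  by have /andP[] := m_fin _ mE.
by apply: filterS => t /(_ I) /= [].
Qed.

End gaussian_translation.

Section directional_derivatives.
Variables (R : realType) (d : nat) (P : probability (d.-tuple R) R).
Hypothesis hP : std_gaussian P.
Variables (F : 'rV[R]_d -> R) (C c : R).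
Hypothesis FC : exp_lipschitz F C c.
Implicit Types v w : 'rV[R]_d.

Definition ddir v (t : d.-tuple R) : R := limn_sup (fun n => dq F v n (rv t)).

Lemma dq_ae_cvg_ddir v :
  {ae P, forall t, (fun n => dq F v n (rv t)) @ \oo --> ddir v t}.
Proof.
exists [set t | ~ cvgn (fun n => dq F v n (rv t))]; split.
- by apply: measurableC; exact: (measurable_cvg_dq (@measurable_rv _ _) FC).
- exact: (dq_ae_cvg hP FC).
- by move=> t /= nc cv; apply: nc; rewrite /ddir cvg_limn_supE.
Qed.

Lemma measurable_ddir v : measurable_fun setT (ddir v).
Proof. exact: (measurable_limsup_dq (@measurable_rv _ _) FC). Qed.

Lemma measurable_dq_rv v n : measurable_fun setT (fun t : d.-tuple R => dq F v n (rv t)).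
Proof. exact: (measurable_dq (@measurable_rv _ _) FC). Qed.

Lemma dq_rv_bound v n (t : d.-tuple R) : `|dq F v n (rv t)| <=
  C * expR (c * enorm v) * enorm v * expR (2 * c * enorm (rv t)).
Proof.
rewrite (le_trans (dq_bound v n (rv t) FC))//.
have -> : c * (2 * enorm (rv t) + enorm v) = c * enorm v + 2 * c * enorm (rv t) by ring.
by rewrite expRD mulrA mulrAC.
Qed.

Lemma ddir_dominated v (A : set (d.-tuple R)) : measurable A ->
  P.-integrable setT (fun t => (\1_A t * ddir v t)%:E) /\
  (\int[P]_t (\1_A t * dq F v n (rv t)))%R @[n --> \oo] --> (\int[P]_t (\1_A t * ddir v t))%R.
Proof.
move=> mA; apply: Rdominated_convergence.
- by move=> n; apply: measurable_funM; [exact: measurable_indic|exact: measurable_dq_rv].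
- by apply: measurable_funM; [exact: measurable_indic|exact: measurable_ddir].
- by apply: filterS (dq_ae_cvg_ddir v) => t; apply: cvgMr.
- exact: (integrable_exp_enorm hP (C * expR (c * enorm v) * enorm v) (2 * c)).
- move=> n t; rewrite (le_trans _ (dq_rv_bound v n t))// normrM ler_piMl//.
  by rewrite indicE ger0_norm// lern1 leq_b1.
Qed.

Lemma integrable_ddir v : P.-integrable setT (EFin \o ddir v).
Proof.
have [+ _] := ddir_dominated v (measurableT : measurable [set: d.-tuple R]).
congr (P.-integrable _ _); apply/funext => t /=.
by rewrite indicE mem_set// mul1r.
Qed.

Lemma integrable_dq_rv (A : set (d.-tuple R)) v n : measurable A ->
  P.-integrable setT (fun t => (\1_A t * dq F v n (rv t))%:E).
Proof.
move=> mA; have := integrable_exp_enorm hP (C * expR (c * enorm v) * enorm v) (2 * c).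
apply: le_integrable => //.
- apply/measurable_EFinP; apply: measurable_funM; first exact: measurable_indic.
  exact: measurable_dq_rv.
- move=> t _; rewrite lee_fin (le_trans _ (ler_norm _))//.
  rewrite (le_trans _ (dq_rv_bound v n t))// normrM ler_piMl//.
  by rewrite indicE ger0_norm// lern1 leq_b1.
Qed.

(** Off the bounding hyperplanes every strict comparison is stable under small translations, so the
    sequence is eventually constant. *)
Lemma indic_orthant_cvg (a : 'I_d -> R) w t : (forall i, tnth t i <> a i) ->
  (\1_(orthant a) (tshift (- (n.+1%:R^-1 *: w)) t) : R) @[n --> \oo] --> (\1_(orthant a) t : R).
Proof.
move=> ta.
have : \forall n \near \oo, forall i,
    (tnth (tshift (- (n.+1%:R^-1 *: w)) t) i < a i) = (tnth t i < a i).
  apply: filter_forall => i.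
  have cv : tnth t i - n.+1%:R^-1 * w 0 i @[n --> \oo] --> (tnth t i - 0 * w 0 i : R).
    by apply: cvgB; [exact: cvg_cst|apply: cvgMl; exact: cvg_harmonic].
  rewrite mul0r subr0 in cv.
  have [ti|ti] := ltP (tnth t i) (a i).
    by apply: filterS (cvgr_lt _ cv _ ti) => n; rewrite tnth_mktuple !mxE => ->.
  have {}ti : a i < tnth t i by rewrite lt_neqAle ti andbT; apply/eqP => /esym; exact: ta.
  apply: filterS (cvgr_gt _ cv _ ti) => n h; rewrite tnth_mktuple !mxE.
  by apply/negbTE; rewrite -leNgt ltW.
move=> H; apply: cvg_near_cst; apply: filterS H => n H.
rewrite !indicE; congr (_%:R); congr nat_of_bool.
by apply/idP/idP => /[!inE] O i; have := O i; rewrite H.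
Qed.

(* dq (v + w) at u is dq w at u plus dq v at u + w/(n+1), and the translation is
   moved onto the indicator and the density. *)
Lemma ddirD_orthant v w a :
  (\int[P]_t (\1_(orthant a) t * ddir (v + w) t) =
   \int[P]_t (\1_(orthant a) t * ddir v t) + \int[P]_t (\1_(orthant a) t * ddir w t))%R.
Proof.
have mA := @measurable_orthant R d a.
have [_ cvgX] := ddir_dominated (v + w) mA.
have [_ cvgZ] := ddir_dominated w mA.
(* The inverse translation sits in the indicator, so that composing [phi n] with the translation
   restores the orthant and moves the base point of dq. *)
pose phi n t := \1_(orthant a) (tshift (- (n.+1%:R^-1 *: w)) t) * dq F v n (rv t).
have mphi n : measurable_fun setT (phi n).
  apply: measurable_funM; last exact: measurable_dq_rv.
  by apply: measurableT_comp; [exact: measurable_indic|exact: measurable_tshift].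
have [_ cvgY] : P.-integrable setT (EFin \o (fun t => \1_(orthant a) t * ddir v t)) /\
    (\int[P]_t (phi n t * girsanov (n.+1%:R^-1 *: w) t))%R @[n --> \oo] -->
    (\int[P]_t (\1_(orthant a) t * ddir v t))%R.
  apply: Rdominated_convergence.
  - by move=> n; apply: measurable_funM; [exact: mphi|exact: measurable_girsanov].
  - by apply: measurable_funM; [exact: measurable_indic|exact: measurable_ddir].
  - have ae1 : {ae P, forall t, forall i, tnth t i <> a i}.
      apply: filter_forall => i; exists [set t | tnth t i = a i]; split.
      + rewrite [X in measurable X](_ : _ = (@tnth _ R ^~ i) @^-1` [set a i])//.
        by rewrite -[X in measurable X]setTI; exact: measurable_tnth.
      + exact: coord_ae_neq.
      + by move=> t /= /contrapT.
    apply: filterS2 ae1 (dq_ae_cvg_ddir v) => t ta tv.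
    rewrite -[X in _ --> X]mulr1; apply: cvgM; last exact: girsanov_cvg.
    by apply: cvgM => //; exact: indic_orthant_cvg.
  - exact: (integrable_exp_enorm hP (C * expR (c * enorm v) * enorm v) (2 * c + enorm w)).
  - move=> n t; rewrite normrM (ger0_norm (girsanov_ge0 _ _)) mulrDl expRD mulrA.
    apply: ler_pM; rewrite ?girsanov_ge0//.
      rewrite (le_trans _ (dq_rv_bound v n t))// normrM ler_piMl//.
      by rewrite indicE ger0_norm// lern1 leq_b1.
    rewrite (le_trans (girsanov_le _ _))// ler_expR ler_wpM2r ?enorm_ge0// enormZ.
    by rewrite ger0_norm// ler_piMl ?enorm_ge0// invf_le1 ?ltr0n// ler1n.
have E n : (\int[P]_t (\1_(orthant a) t * dq F (v + w) n (rv t)) =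
  \int[P]_t (phi n t * girsanov (n.+1%:R^-1 *: w) t) +
  \int[P]_t (\1_(orthant a) t * dq F w n (rv t)))%R.
  rewrite -(girsanov_integral_real hP _ (mphi n)).
  have phiE t : phi n (tshift (n.+1%:R^-1 *: w) t) =
      \1_(orthant a) t * dq F (v + w) n (rv t) - \1_(orthant a) t * dq F w n (rv t).
    rewrite /phi (_ : tshift _ (tshift _ t) = t); last first.
      by apply: eq_from_tnth => i; rewrite !tnth_mktuple !mxE addrK.
    rewrite rv_tshift -mulrBr; congr (_ * _).
    by rewrite /dq scalerDr (addrC (_ *: v)) addrA; ring.
  under [X in _ = X + _]eq_Rintegral do rewrite phiE.
  by rewrite RintegralB ?subrK//; exact: integrable_dq_rv.
move: cvgX; rewrite (funext E) => cvgX.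
exact: (cvg_unique (@Rhausdorff R) cvgX (cvgD cvgY cvgZ)).
Qed.

Lemma ddirD v w : {ae P, forall t, ddir (v + w) t = ddir v t + ddir w t}.
Proof.
have int : P.-integrable setT (EFin \o (fun t => ddir (v + w) t - (ddir v t + ddir w t))).
  apply: (@integrableB _ _ _ P setT measurableT (EFin \o ddir (v + w))
    (EFin \o (fun t => ddir v t + ddir w t))); first exact: integrable_ddir.
  by apply: (@integrableD _ _ _ P setT measurableT (EFin \o ddir v) (EFin \o ddir w));
    exact: integrable_ddir.
apply: filterS (orthant_ae_eq0 int _) => [t /eqP|a]; first by rewrite subr_eq0 => /eqP.
have mA := @measurable_orthant R d a.
have intA := integrableS measurableT mA (@subsetT _ _) int.
rewrite -(fineK (integrable_fin_num mA intA)); congr EFin.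
transitivity (\int[P]_t (\1_(orthant a) t * ddir (v + w) t -
  (\1_(orthant a) t * ddir v t + \1_(orthant a) t * ddir w t)))%R.
  rewrite -/(Rintegral P (orthant a) (fun t => ddir (v + w) t - (ddir v t + ddir w t))).
  rewrite Rintegral_mkcond; apply: eq_Rintegral => t _; rewrite patchE indicE.
  by case: ifPn => _; rewrite ?mul1r// !mul0r addr0 subrr.
have i v' := (ddir_dominated v' mA).1.
rewrite RintegralB//; [|exact: i|exact: (integrableD measurableT (i v) (i w))].
rewrite ddirD_orthant; apply/eqP; rewrite subr_eq0; apply/eqP/esym.
by apply: (RintegralD measurableT); exact: i.
Qed.

Lemma ddir0 t : ddir 0 t = 0.
Proof.
rewrite /ddir (_ : (fun n => _) = cst 0).
  have c0 : (cst 0 : nat -> R) @ \oo --> (0 : R) by exact: cvg_cst.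
  by have [_ ->] := cvg_limn_inf_sup c0.
by apply/funext => n; rewrite /dq scaler0 addr0 subrr mulr0.
Qed.

Definition linear_direction v := {ae P, forall t, ddir v t = inner (dgrad F (rv t)) v}.

Lemma linear_directionD v w :
  linear_direction v -> linear_direction w -> linear_direction (v + w).
Proof.
by move=> lv lw; apply: filterS3 lv lw (ddirD v w) => t lv lw ->; rewrite lv lw innerDr.
Qed.

Lemma linear_direction0 : linear_direction 0.
Proof. by apply: aeW => t; rewrite ddir0 -(scale0r (0 : 'rV[R]_d)) innerZr mul0r. Qed.

Lemma linear_directionN v : linear_direction v -> linear_direction (- v).
Proof.
move=> lv; apply: filterS2 lv (ddirD v (- v)) => t lv.
by rewrite subrr ddir0 lv innerNr => /eqP; rewrite eq_sym addr_eq0 => /eqP ->; rewrite opprK.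
Qed.

Lemma linear_direction_delta i : linear_direction (delta_mx 0 i).
Proof. by apply: aeW => t; rewrite inner_delta mxE. Qed.

(** The basis vectors satisfy the claim by definition of [dgrad], and integer vectors are what
    additivity alone generates from them. *)
Lemma linear_direction_intv (k : 'I_d -> int) : linear_direction (intv R k).
Proof.
rewrite (row_sum_delta (intv R k)).
apply: (big_ind linear_direction); [exact: linear_direction0|exact: linear_directionD|].
move=> i _; rewrite mxE scaler_int.
have ln n : linear_direction (delta_mx 0 i *+ n).
  elim: n => [|n IH]; first by rewrite mulr0n; exact: linear_direction0.
  by rewrite mulrS; apply: linear_directionD => //; exact: linear_direction_delta.
by case: (k i) => n; [exact: ln|rewrite NegzE mulrNz; apply: linear_directionN; exact: ln].
Qed.

Theorem gaussian_rademacher : {ae P, forall t, differentiable F (rv t)}.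
Proof.
have H (k : {ffun 'I_d -> int}) : P.-negligible
    [set t | ~ ((fun n => dq F (intv R k) n (rv t)) @ \oo -->
                inner (dgrad F (rv t)) (intv R k))].
  have : {ae P, forall t, (fun n => dq F (intv R k) n (rv t)) @ \oo -->
                inner (dgrad F (rv t)) (intv R k)}.
    by apply: filterS2 (linear_direction_intv k) (dq_ae_cvg_ddir (intv R k)) => t ->.
  by apply: negligibleS.
pose N n : set (d.-tuple R) := if unpickle n is Some k then
  [set t | ~ ((fun n => dq F (intv R (k : {ffun 'I_d -> int})) n (rv t)) @ \oo -->
                inner (dgrad F (rv t)) (intv R k))] else set0.
have : P.-negligible (\bigcup_n N n).
  apply: negligible_bigcup => n; rewrite /N; case: unpickle => [k|]; first exact: H.
  exact: negligible_set0.
apply: negligibleS => t /= nd; apply: contrapT => nN; apply: nd.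
have /(diff_dq_linear_at (exp_lipschitz_locally FC))[] // : dq_linear_at F (rv t).
move=> k; apply: contrapT => nk; apply: nN; exists (pickle k) => //.
by rewrite /N pickleK.
Qed.

End directional_derivatives.

Lemma diff_expand_rV (R : realType) (d : nat) (f : 'rV[R]_d -> R) (y : 'rV[R]_d) :
  differentiable f y -> forall e : R, 0 < e -> exists2 r : R, 0 < r &
    forall h : 'rV[R]_d, `|h| < r -> `|f (y + h) - f y - inner (grad f y) h| <= e * `|h|.
Proof.
move=> df e e0; have := diff_locally df.
move=> /eqaddoP/(_ _ e0)/nbhs_ballP[r /= r0 rH].
exists r => // h hr; have := rH h; rewrite mx_norm_ball /ball_/= sub0r normrN => /(_ hr).
by rewrite /= inner_grad !fctE [y + h]addrC opprD addrA.
Qed.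

Lemma Rintegral_sum (d : measure_display) (T : measurableType d) (R : realType)
  (mu : {measure set T -> \bar R}) (I : Type) (s : seq I) (f : I -> T -> R) :
  (forall i, mu.-integrable setT (EFin \o f i)) ->
  mu.-integrable setT (EFin \o (fun t => \sum_(i <- s) f i t)) /\
  (\int[mu]_t (\sum_(i <- s) f i t) = \sum_(i <- s) \int[mu]_t f i t)%R.
Proof.
move=> fi; elim: s => [|i s [IH1 IH2]].
  under [X in EFin \o X]eq_fun do rewrite big_nil.
  split; first exact: integrable0.
  by rewrite big_nil; under eq_Rintegral do rewrite big_nil; rewrite /Rintegral integral0.
have E : (fun t => \sum_(j <- i :: s) f j t) = (fun t => f i t + \sum_(j <- s) f j t).
  by apply/funext => t; rewrite big_cons.
rewrite E; split; first exact: (integrableD measurableT (fi i) IH1).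
by rewrite (RintegralD measurableT (fi i) IH1) IH2 big_cons.
Qed.

Lemma Rintegral_inner (d' : measure_display) (T : measurableType d') (R : realType)
  (d : nat) (mu : {measure set T -> \bar R}) (V : T -> 'rV[R]_d) (h : 'rV[R]_d) :
  (forall i, mu.-integrable setT (EFin \o (fun t => V t 0 i))) ->
  mu.-integrable setT (EFin \o (fun t => inner (V t) h)) /\
  (\int[mu]_t inner (V t) h = inner (\row_i \int[mu]_t V t 0 i) h)%R.
Proof.
move=> Vi.
have Vhi i : mu.-integrable setT (EFin \o (fun t => V t 0 i * h 0 i)).
  have := integrableZl measurableT (h 0 i) (Vi i).
  by congr (mu.-integrable _ _); apply/funext => t /=; rewrite -EFinM mulrC.
have [i1 i2] := Rintegral_sum (index_enum 'I_d) Vhi.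
split=> //; rewrite i2; apply: eq_bigr => i _.
by rewrite mxE RintegralZr//; exact: Vi.
Qed.

Lemma exp_lipschitz_affine (R : realType) (d : nat) (f : 'rV[R]_d -> R) (C c : R)
    (x : 'rV[R]_d) (sigma : R) : 0 <= sigma -> exp_lipschitz f C c ->
  exp_lipschitz (fun u => f (x + sigma *: u)) (C * sigma * expR (2 * c * enorm x)) (c * sigma).
Proof.
move=> s0 [C0 c0 fC]; split; [by rewrite !mulr_ge0// expR_ge0|exact: mulr_ge0|].
move=> y z; rewrite (le_trans (fC _ _))//.
have -> : x + sigma *: y - (x + sigma *: z) = sigma *: (y - z).
  by rewrite opprD addrACA subrr add0r scalerBr.
rewrite enormZ (ger0_norm s0).
have b w : enorm (x + sigma *: w) <= enorm x + sigma * enorm w.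
  by rewrite (le_trans (enormD _ _))// enormZ ger0_norm.
have : expR (c * (enorm (x + sigma *: y) + enorm (x + sigma *: z))) <=
    expR (2 * c * enorm x) * expR (c * sigma * (enorm y + enorm z)).
  rewrite -expRD ler_expR.
  have -> : 2 * c * enorm x + c * sigma * (enorm y + enorm z) =
    c * ((enorm x + sigma * enorm y) + (enorm x + sigma * enorm z)) by ring.
  by rewrite ler_wpM2l// lerD.
have D0 : 0 <= C * (sigma * enorm (y - z)) by rewrite !mulr_ge0// enorm_ge0.
move=> /(ler_wpM2l D0).
by congr (_ <= _); ring.
Qed.

Lemma differentiable_affine (R : realType) (d : nat) (f : 'rV[R]_d -> R)
    (x u : 'rV[R]_d) (sigma : R) : sigma != 0 ->
  differentiable (fun w => f (x + sigma *: w)) u -> differentiable f (x + sigma *: u).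
Proof.
move=> s0 dF.
have -> : f = (fun w => f (x + sigma *: w)) \o (fun y => sigma^-1 *: (y - x)).
  by apply/funext => y /=; rewrite scalerA mulfV// scale1r subrKC.
apply: differentiable_comp.
  by apply: differentiableZ; apply: differentiableB.
by rewrite addrAC subrr add0r scalerA mulVf// scale1r.
Qed.

(** * Gradient of the smoothing *)

Section SPB_growth.
Variables (R : realType) (d : nat) (f : 'rV[R]_d -> R) (R1 R2 : R) (m : nat).
Hypothesis hf : SPB f R1 R2 m.

Lemma expn_le_expR (r : R) : 0 <= r -> r ^+ m <= expR (m%:R * r).
Proof.
move=> r0; rewrite mulrC expRM_natr lerXn2r ?nnegrE ?expR_ge0//.
by rewrite (le_trans _ (expR_ge1Dx r))// lerDr.
Qed.

Lemma SPB_weight_le (r : R) : 0 <= r -> R1 * r ^+ m + R2 <= (R1 + R2) * expR (m%:R * r).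
Proof.
have [R10 [R20 _]] := hf.
move=> r0; rewrite mulrDl lerD ?ler_wpM2l ?expn_le_expR//.
by rewrite ler_peMr ?(ltW R20)// -expR0 ler_expR mulr_ge0.
Qed.

Lemma SPB_exp_lipschitz : exp_lipschitz f (R1 + R2) m%:R.
Proof.
have [R10 [R20 [_ [flip _]]]] := hf.
split; [by rewrite addr_ge0 ?(ltW R20)|exact: ler0n|move=> y z].
have := @SPB_lipschitz _ _ _ flip _ _ _ (enorm y + enorm z) y z hf.
rewrite lerDl lerDr !enorm_ge0 => /(_ isT isT)/le_trans; apply.
by rewrite ler_wpM2r ?enorm_ge0// SPB_weight_le// addr_ge0 ?enorm_ge0.
Qed.

Lemma SPB_grad_le (y : 'rV[R]_d) : differentiable f y ->
  enorm (grad f y) <= R1 * enorm y ^+ m + R2.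
Proof. by have [_ [_ [_ [_ fR]]]] := hf; move=> /grad_clarke/fR. Qed.

End SPB_growth.

Section smoothing_gradient.
Variables (R : realType) (d : nat) (P : probability (d.-tuple R) R).
Hypothesis hP : std_gaussian P.
Variables (f : 'rV[R]_d -> R) (R1 R2 : R) (m : nat).
Hypothesis hf : SPB f R1 R2 m.
Variables (sigma : R) (x : 'rV[R]_d).
Hypothesis s0 : 0 < sigma.

Let R10 : 0 <= R1. Proof. by have [] := hf. Qed.
Let R20 : 0 < R2. Proof. by have [_ []] := hf. Qed.
Let fC := SPB_exp_lipschitz hf.
Let cf : continuous f.
Proof. exact: locally_lipschitz_continuous (exp_lipschitz_locally fC). Qed.

Local Notation phi := (fun t : d.-tuple R => x + sigma *: rv t).

Lemma integrable_le_exp (g : d.-tuple R -> R) (b a : R) : measurable_fun setT g ->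
  (forall t, `|g t| <= b * expR (a * enorm (rv t))) -> P.-integrable setT (EFin \o g).
Proof.
move=> mg gb; apply: le_integrable (integrable_exp_enorm hP b a) => //.
  exact/measurable_EFinP.
by move=> t _; rewrite /= lee_fin (le_trans (gb t))// ler_norm.
Qed.

Lemma measurable_affine_rv (y : 'rV[R]_d) (i : 'I_d) :
  measurable_fun setT (fun t : d.-tuple R => (y + sigma *: rv t) 0 i).
Proof.
under eq_fun do rewrite !mxE.
by apply: measurable_funD => //; apply: measurable_funM => //; exact: measurable_tnth.
Qed.

Lemma enorm_affine_le (y u : 'rV[R]_d) :
  enorm (y + sigma *: u) <= enorm y + sigma * enorm u.
Proof. by rewrite (le_trans (enormD _ _))// enormZ gtr0_norm. Qed.

Definition diff_set : set (d.-tuple R) := [set t | differentiable f (phi t)].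

Lemma measurable_diff_set : measurable diff_set.
Proof. exact: (measurable_differentiable (measurable_affine_rv x) fC). Qed.

Lemma ae_diff_set : {ae P, forall t, diff_set t}.
Proof.
have FC := exp_lipschitz_affine x (ltW s0) fC.
apply: filterS (gaussian_rademacher hP FC) => t.
by apply: differentiable_affine; rewrite gt_eqF.
Qed.

(** The integrand of (i). It is written with [dgrad], which is measurable everywhere, while [grad f]
    is arbitrary off the differentiability set; on that set both agree. *)
Definition gradD t : 'rV[R]_d := \1_diff_set t *: dgrad f (phi t).

Lemma gradDE t : diff_set t -> gradD t = grad f (phi t).
Proof. by move=> Dt; rewrite /gradD indicE mem_set// scale1r dgrad_diff. Qed.

Lemma gradD0 t : ~ diff_set t -> gradD t = 0.
Proof. by move=> Dt; rewrite /gradD indicE memNset// scale0r. Qed.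

Lemma measurable_gradD i : measurable_fun setT (fun t => gradD t 0 i).
Proof.
under eq_fun do rewrite mxE.
apply: measurable_funM; first exact: measurable_indic measurable_diff_set.
exact: (measurable_dgrad (measurable_affine_rv x) fC).
Qed.

Lemma gradD_le t : enorm (gradD t) <= R1 * enorm (phi t) ^+ m + R2.
Proof.
have [Dt|Dt] := pselect (diff_set t); first by rewrite gradDE//; exact: SPB_grad_le.
by rewrite gradD0// enorm0 addr_ge0 ?(ltW R20)// mulr_ge0// exprn_ge0// enorm_ge0.
Qed.

Lemma gradD_le_exp t : enorm (gradD t) <=
  (R1 + R2) * expR (m%:R * enorm x) * expR (m%:R * sigma * enorm (rv t)).
Proof.
rewrite (le_trans (gradD_le t))// (le_trans (SPB_weight_le hf (enorm_ge0 _)))//.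
rewrite -mulrA -expRD ler_wpM2l ?addr_ge0 ?(ltW R20)// ler_expR -mulrA -mulrDr.
by rewrite ler_wpM2l// enorm_affine_le.
Qed.

Lemma integrable_gradD i : P.-integrable setT (EFin \o (fun t => gradD t 0 i)).
Proof.
apply: integrable_le_exp (measurable_gradD i) _ => t.
exact: le_trans (ler_coord_enorm _ _) (gradD_le_exp t).
Qed.

Lemma measurable_f_affine (y : 'rV[R]_d) :
  measurable_fun setT (fun t : d.-tuple R => f (y + sigma *: rv t)).
Proof. exact: (measurable_continuous_rV (measurable_affine_rv y) cf). Qed.

Lemma integrable_f_affine (y : 'rV[R]_d) :
  P.-integrable setT (EFin \o (fun t => f (y + sigma *: rv t))).
Proof.
have [C0 c0 FC] := exp_lipschitz_affine y (ltW s0) fC.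
set C' := (X in 0 <= X) in C0; set c' := m%:R * sigma in c0.
apply: (@integrable_le_exp _ (`|f y| + C') (c' + 1) (measurable_f_affine y)) => t.
have := FC (rv t) 0; rewrite enorm0 addr0 subr0 scaler0 addr0 -/C' -/c' => FCt.
have e1 : 1 <= expR ((c' + 1) * enorm (rv t)).
  by rewrite -expR0 ler_expR mulr_ge0 ?enorm_ge0// addr_ge0.
have e2 : expR (c' * enorm (rv t)) * enorm (rv t) <= expR ((c' + 1) * enorm (rv t)).
  rewrite mulrDl expRD mul1r ler_wpM2l ?expR_ge0//.
  by rewrite (le_trans _ (expR_ge1Dx _))// lerDr.
rewrite -[f _](subrK (f y)) (le_trans (ler_normD _ _))// addrC mulrDl lerD//.
  by rewrite ler_peMr.
by rewrite (le_trans FCt)// -mulrA ler_wpM2l.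
Qed.

(** Divided by |h|, the right side is the dominating function of the normalized remainder. The
    increment of f and the linear term obey the same exponential bound, whence the factor 2. *)
Lemma smoothing_remainder_le (h : 'rV[R]_d) t : `|h| <= 1 ->
  `|f (phi t + h) - f (phi t) - inner (gradD t) h| <=
  2 * (R1 + R2) * expR (m%:R * (2 * enorm x + d%:R)) * d%:R *
    expR (2 * m%:R * sigma * enorm (rv t)) * `|h|.
Proof.
move=> h1; have [C0 c0 fCl] := fC.
have hd : enorm h <= d%:R * `|h| := ler_enorm_norm h.
have hd1 : enorm h <= d%:R by rewrite (le_trans hd)// ler_piMr.
have pt := enorm_affine_le x (rv t).
set a := enorm (phi t) in pt.
pose E := expR (m%:R * (2 * enorm x + d%:R)) * expR (2 * m%:R * sigma * enorm (rv t)).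
have EE b : b <= m%:R * (2 * enorm x + d%:R) + 2 * m%:R * sigma * enorm (rv t) ->
    (R1 + R2) * expR b * enorm h <= (R1 + R2) * E * (d%:R * `|h|).
  move=> bE; apply: ler_pM => //; rewrite ?mulr_ge0 ?expR_ge0 ?enorm_ge0//.
  by rewrite ler_wpM2l// /E -expRD ler_expR.
have r0 : 0 <= sigma * enorm (rv t) by rewrite mulr_ge0 ?enorm_ge0 ?(ltW s0).
have x0 := enorm_ge0 x.
have b1 : `|f (phi t + h) - f (phi t)| <= (R1 + R2) * E * (d%:R * `|h|).
  rewrite (le_trans (fCl _ _))// (addrC (phi t)) addrK; apply: EE.
  have -> : m%:R * (2 * enorm x + d%:R) + 2 * m%:R * sigma * enorm (rv t) =
    m%:R * ((enorm x + sigma * enorm (rv t) + d%:R) + (enorm x + sigma * enorm (rv t))).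
    by ring.
  rewrite ler_wpM2l//; have := enormD h (phi t); rewrite -/a; lra.
have b2 : `|inner (gradD t) h| <= (R1 + R2) * E * (d%:R * `|h|).
  rewrite (le_trans (norm_inner_le _ _))//.
  rewrite (le_trans (ler_wpM2r (enorm_ge0 h) (gradD_le_exp t)))//.
  rewrite -(mulrA (R1 + R2)) -expRD; apply: EE.
  have -> : m%:R * (2 * enorm x + d%:R) + 2 * m%:R * sigma * enorm (rv t) =
    m%:R * ((enorm x + sigma * enorm (rv t)) + (enorm x + sigma * enorm (rv t) + d%:R)).
    by ring.
  rewrite -mulrA -mulrDr ler_wpM2l// lerDl addr_ge0// addr_ge0//.
rewrite (le_trans (ler_normB _ _))//.
have -> : 2 * (R1 + R2) * expR (m%:R * (2 * enorm x + d%:R)) * d%:R *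
    expR (2 * m%:R * sigma * enorm (rv t)) * `|h| =
    (R1 + R2) * E * (d%:R * `|h|) + (R1 + R2) * E * (d%:R * `|h|).
  by rewrite /E; ring.
exact: lerD.
Qed.

(** Dominated convergence concerns sequences, so a failure of the first-order expansion is first
    turned into increments h n -> 0 violating it. The normalized remainders then tend to 0 almost
    everywhere, hence in mean, which contradicts the violation. *)
Lemma smoothing_grad : differentiable (smoothing P f sigma) x /\
  grad (smoothing P f sigma) x = \row_i (\int[P]_t gradD t 0 i)%R.
Proof.
apply: differentiable_grad_rV => e e0; apply: contrapT => nex.
set g := \row_i (\int[P]_t gradD t 0 i)%R in nex.
have /choice[h hP'] : forall n : nat, exists h : 'rV[R]_d, `|h| < n.+1%:R^-1 /\
    e * `|h| < `|smoothing P f sigma (x + h) - smoothing P f sigma x - inner g h|.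
  move=> n; apply: contrapT => nh; apply: nex; exists n.+1%:R^-1; first by rewrite invr_gt0.
  move=> h hn; rewrite leNgt; apply/negP => he; apply: nh; by exists h.
(* The strict violation is impossible at h = 0, so division by [|h n|] is legitimate. *)
have h0 n : 0 < `|h n|.
  rewrite normr_gt0; apply/eqP => hn0; have := (hP' n).2.
  rewrite hn0 normr0 mulr0 addr0 subrr sub0r normrN.
  by rewrite -(scale0r (0 : 'rV[R]_d)) innerZr mul0r normr0 ltxx.
pose r n t := (f (phi t + h n) - f (phi t) - inner (gradD t) (h n)) / `|h n|.
have phiE n t : phi t + h n = x + h n + sigma *: rv t by rewrite addrAC.
have intG n := Rintegral_inner (h n) integrable_gradD.
have mr n : measurable_fun setT (r n).
  apply: measurable_funM => //; apply: measurable_funB.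
    apply: measurable_funB; last exact: measurable_f_affine.
    by under eq_fun do rewrite phiE; exact: measurable_f_affine.
  by apply/measurable_EFinP; exact: measurable_int (intG n).1.
have Er n : (\int[P]_t r n t)%R =
    (smoothing P f sigma (x + h n) - smoothing P f sigma x - inner g (h n)) / `|h n|.
  have i1 := integrable_f_affine (x + h n); have i2 := integrable_f_affine x.
  have i12 := integrableB measurableT i1 i2.
  rewrite /r RintegralZr//; last first.
    under [X in EFin \o X]eq_fun do rewrite phiE.
    exact: (integrableB measurableT i12 (intG n).1).
  under eq_Rintegral do rewrite phiE.
  by rewrite (RintegralB measurableT i12 (intG n).1) (RintegralB measurableT i1 i2) (intG n).2.
have [_] : P.-integrable setT (EFin \o (cst 0 : d.-tuple R -> R)) /\
    (\int[P]_t r n t)%R @[n --> \oo] --> (\int[P]_t (cst 0 : d.-tuple R -> R) t)%R.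
  apply: Rdominated_convergence mr _ _
    (integrable_exp_enorm hP (2 * (R1 + R2) * expR (m%:R * (2 * enorm x + d%:R)) * d%:R)
       (2 * m%:R * sigma)) _ => //.
    apply: filterS ae_diff_set => t Dt; apply/cvgrPdist_le => eps eps0.
    have [q q0 qH] := diff_expand_rV Dt eps0.
    near=> n; rewrite sub0r normrN normrM normfV normr_id ler_pdivrMr// gradDE//.
    apply: qH; apply: lt_trans (hP' n).1 _.
    near: n; have /cvgr_lt := @cvg_harmonic R; exact.
  move=> n t; rewrite normrM normfV normr_id ler_pdivrMr//.
  apply: smoothing_remainder_le; rewrite (le_trans (ltW (hP' n).1))//.
  by rewrite invf_le1 ?ltr0n// ler1n.
rewrite [X in _ --> X](_ : _ = 0); last by rewrite /Rintegral integral0.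
move=> /cvgrPdist_lt/(_ _ e0)[n _ /(_ n (leqnn n))].
rewrite sub0r normrN Er normrM normfV normr_id ltr_pdivrMr//.
by rewrite ltNge ltW//; exact: (hP' n).2.
Unshelve. all: by end_near. Qed.

End smoothing_gradient.

(** Pairing the mean v with itself: |v|^2 is the integral of <V, v>, at most |v| times the integral
    of W. *)
Lemma enorm_Rintegral_le (d' : measure_display) (T : measurableType d') (R : realType)
  (d : nat) (mu : {measure set T -> \bar R}) (V : T -> 'rV[R]_d) (W : T -> R) :
  (forall i, mu.-integrable setT (EFin \o (fun t => V t 0 i))) ->
  mu.-integrable setT (EFin \o W) -> (forall t, enorm (V t) <= W t) ->
  enorm (\row_i (\int[mu]_t V t 0 i)%R) <= (\int[mu]_t W t)%R.
Proof.
move=> Vi Wi VW; set v := \row_i _.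
have W0 : 0 <= (\int[mu]_t W t)%R.
  by apply: Rintegral_ge0 => t _; exact: le_trans (enorm_ge0 _) (VW t).
have [->//|v0] := eqVneq (enorm v) 0.
have {}v0 : 0 < enorm v by rewrite lt_def v0 enorm_ge0.
have [i1 i2] := Rintegral_inner v Vi.
rewrite -(ler_pM2r v0) -expr2 -inner_self -i2 -RintegralZr//.
apply: le_Rintegral => //.
  have := integrableZr measurableT (enorm v) Wi.
  by congr (mu.-integrable _ _); apply/funext => t /=; rewrite -EFinM.
by move=> t _; rewrite (le_trans (inner_le _ _))// ler_wpM2r ?enorm_ge0.
Qed.

(** * Goldstein approximation *)

Section convex_hull.
Variables (R : realType) (d : nat).
Implicit Types (A : set 'rV[R]_d) (x y z : 'rV[R]_d).

Lemma conv1 A x : A x -> Defs.conv A x.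
Proof.
move=> Ax; exists 1%N, (fun=> 1), (fun=> x); split=> [i|]; first exact: ler01.
by rewrite !big_ord1 scale1r.
Qed.

Lemma conv_sub A B : A `<=` B -> Defs.conv A `<=` Defs.conv B.
Proof.
move=> AB z [n [w [p [w0 [w1 [Ap ->]]]]]].
by exists n, w, p; split=> //; split=> //; split=> // i; exact: AB.
Qed.

Lemma conv_mix A x y (l : R) : 0 <= l <= 1 -> Defs.conv A x -> Defs.conv A y ->
  Defs.conv A ((1 - l) *: x + l *: y).
Proof.
move=> /andP[l0 l1] [n [w [p [w0 [w1 [Ap ->]]]]]] [k [w' [p' [w0' [w1' [Ap' ->]]]]]].
pose mix T (a : 'I_n -> T) (b : 'I_k -> T) (i : 'I_(n + k)) :=
  match fintype.split i with inl i => a i | inr i => b i end.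
have mixl T (a : 'I_n -> T) b i : mix T a b (lshift k i) = a i.
  by rewrite /mix (unsplitK (inl i)).
have mixr T (a : 'I_n -> T) b i : mix T a b (rshift n i) = b i.
  by rewrite /mix (unsplitK (inr i)).
exists (n + k)%N, (mix _ (fun i => (1 - l) * w i) (fun i => l * w' i)), (mix _ p p').
split.
  by move=> i; rewrite /mix; case: fintype.split => j; rewrite mulr_ge0// subr_ge0.
split.
  rewrite big_split_ord/=.
  under eq_bigr do rewrite mixl; rewrite -mulr_sumr w1.
  by under eq_bigr do rewrite mixr; rewrite -mulr_sumr w1' !mulr1 subrK.
split; first by move=> i; rewrite /mix; case: fintype.split.
rewrite big_split_ord/= !scaler_sumr.
by congr +%R; apply: eq_bigr => i _; rewrite ?mixl ?mixr scalerA.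
Qed.

Lemma conv_enorm_le A (B : R) x : (forall y, A y -> enorm y <= B) -> Defs.conv A x -> enorm x <= B.
Proof.
move=> AB [n [w [p [w0 [w1 [Ap ->]]]]]]; rewrite (le_trans (enorm_sum _))//.
rewrite -[leRHS]mul1r -w1 mulr_suml ler_sum// => i _.
by rewrite enormZ ger0_norm// ler_wpM2l// AB.
Qed.

(* A point of the hull almost as near to x as possible almost satisfies the
   variational inequality of the projection of x on the hull. *)
Lemma conv_near_projection A x (B e : R) : A !=set0 -> (forall y, A y -> enorm y <= B) ->
  0 < e -> exists2 g, Defs.conv A g & forall y, A y -> inner (y - g) (x - g) <= e.
Proof.
move=> [a0 Aa0] AB e0.
pose D := [set enorm (x - g) ^+ 2 | g in Defs.conv A].
have D0 : has_inf D.
  split; first by exists (enorm (x - a0) ^+ 2); exists a0 => //; exact: conv1.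
  by exists 0 => _ [g _ <-]; exact: sqr_ge0.
have B0 : 0 <= B by rewrite (le_trans (enorm_ge0 a0))// AB.
(* g is chosen within l^2 of the infimum, and moving from g towards y by l gives 2 l <y - g, x - g>
   <= l^2 + l^2 (2 B)^2 = 2 l^2 c. Hence l c <= e suffices. *)
pose c := (1 + (2 * B) ^+ 2) / 2.
have c0 : 0 < c by rewrite divr_gt0// ltr_pwDl// sqr_ge0.
pose l := Num.min 1 (e / c).
have l0 : 0 < l by rewrite lt_min ltr01 divr_gt0.
have l1 : l <= 1 by rewrite ge_min lexx.
have lc : l * c <= e by rewrite -ler_pdivlMr// ge_min lexx orbT.
have [_ [g Ag <-]] := inf_adherent (exprn_gt0 2 l0) D0.
move=> gD; exists g => // y Ay.
have gB : enorm g <= B := conv_enorm_le AB Ag.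
have yB := AB _ Ay.
have : inf D <= enorm (x - ((1 - l) *: g + l *: y)) ^+ 2.
  apply: ge_inf; first exact: D0.2.
  by exists ((1 - l) *: g + l *: y) => //; apply: conv_mix; rewrite ?l1 ?(ltW l0)//; exact: conv1.
have -> : x - ((1 - l) *: g + l *: y) = (x - g) + (- l) *: (y - g).
  by apply/rowP => i; rewrite !mxE; ring.
have yg : enorm (y - g) ^+ 2 <= (2 * B) ^+ 2.
  rewrite lerXn2r ?nnegrE ?enorm_ge0 ?mulr_ge0//.
  by rewrite (le_trans (enormD _ _))// enormN; lra.
have lyg : l ^+ 2 * enorm (y - g) ^+ 2 <= l ^+ 2 * (2 * B) ^+ 2 by rewrite ler_wpM2l// sqr_ge0.
move=> hi; apply: le_trans lc; rewrite -(ler_pM2l l0) /c; move: hi.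
move: lyg gD; move: (x - g) (y - g) => a b lyg gD.
rewrite -inner_self innerDl !innerDr !innerZl !innerZr !inner_self (innerC a).
move: lyg gD; move: (inner b a) (enorm a ^+ 2) (enorm b ^+ 2) (inf D) => u X Y iD; lra.
Qed.

End convex_hull.

(** Take g almost projecting the mean mu over S. The inequality <V - g, mu - g> <= e^2, integrated
    over S, becomes p |mu - g|^2 <= p e^2. *)
Lemma conv_mean_approx (d' : measure_display) (T : measurableType d') (R : realType)
  (d : nat) (P : probability T R) (V : T -> 'rV[R]_d) (S : set T) (B e : R) :
  measurable S -> (forall i, P.-integrable setT (EFin \o (fun t => \1_S t * V t 0 i))) ->
  (forall t, S t -> enorm (V t) <= B) -> 0 < fine (P S) -> 0 < e ->
  exists2 g, Defs.conv (V @` S) g &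
    enorm (\row_i (\int[P]_t (\1_S t * V t 0 i))%R - fine (P S) *: g) <= fine (P S) * e.
Proof.
move=> mS Vi VB; set p := fine (P S) => p0 e0.
have [t0 St0] : S !=set0.
  by apply/set0P/eqP => S0; move: p0; rewrite /p S0 measure0 ltxx.
set I := \row_i _.
have := @conv_near_projection R d (V @` S) (p^-1 *: I) B (e ^+ 2).
case.
- by exists (V t0); exists t0.
- by move=> _ [t St <-]; exact: VB.
- by rewrite exprn_gt0.
move=> g Cg gV; exists g => //.
set mu := p^-1 *: I in gV.
have -> : I - p *: g = p *: (mu - g) by rewrite scalerBr scalerA mulfV ?gt_eqF// scale1r.
rewrite enormZ (gtr0_norm p0) ler_wpM2l ?(ltW p0)//.
rewrite -(@ler_pXn2r _ 2)// ?nnegrE ?enorm_ge0 ?(ltW e0)//.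
have mS1 : measurable_fun setT (\1_S : T -> R) by exact: measurable_indic.
have iS : P.-integrable setT (EFin \o (\1_S : T -> R)).
  exact: integrable_indic.
have pE : (\int[P]_t (\1_S t : R))%R = p by rewrite /Rintegral integral_indic// setIT.
pose U t : 'rV[R]_d := \1_S t *: V t.
have Ui i : P.-integrable setT (EFin \o (fun t => U t 0 i)).
  by under [X in EFin \o X]eq_fun do rewrite mxE; exact: Vi.
have [i1 i2] := Rintegral_inner (mu - g) Ui.
have UI : \row_i (\int[P]_t U t 0 i)%R = I.
  by apply/rowP => i; rewrite !mxE; apply: eq_Rintegral => t _; rewrite mxE.
have iSc (c : R) : P.-integrable setT (EFin \o (fun t => \1_S t * c)).
  have := integrableZr measurableT c iS.
  by congr (P.-integrable _ _); apply/funext => t /=; rewrite -EFinM.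
rewrite -(ler_pM2l p0) -pE -[leRHS]RintegralZr//.
have -> : (\int[P]_t \1_S t)%R * enorm (mu - g) ^+ 2 =
    (\int[P]_t (inner (U t) (mu - g) - \1_S t * inner g (mu - g)))%R.
  rewrite (RintegralB measurableT i1 (iSc _)) i2 UI RintegralZr// pE.
  by rewrite -inner_self -innerZl scalerBr scalerA mulfV ?gt_eqF// scale1r innerDl
    -scaleNr innerZl mulNr.
apply: le_Rintegral => //.
  exact: (integrableB measurableT i1 (iSc _)).
move=> t _; rewrite /U innerZl -mulrBr.
have [St|St] := pselect (S t); last by rewrite indicE memNset// !mul0r.
rewrite indicE mem_set// !mul1r.
have := gV _ (imageP V St); rewrite innerDl.
by rewrite -[- g]scaleN1r innerZl mulN1r.
Qed.

(** Convexity of r^m, in a form that also covers m = 0. The induction step amounts to (a - b) (a^m -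
    b^m) >= 0. *)
Lemma exprD_le (R : realFieldType) (a b : R) (m : nat) : 0 <= a -> 0 <= b ->
  2 * (a + b) ^+ m <= 2 ^+ m * (a ^+ m + b ^+ m).
Proof.
move=> a0 b0; elim: m => [|m IH]; first by rewrite !expr0; lra.
rewrite exprS mulrCA (le_trans (ler_wpM2l (addr_ge0 a0 b0) IH))//.
rewrite mulrCA exprSr -[leRHS]mulrA ler_wpM2l ?exprn_ge0// !exprS.
suff : 0 <= (a - b) * (a ^+ m - b ^+ m) by lra.
have [ab|/ltW ab] := leP a b.
  by rewrite mulr_le0// subr_le0// lerXn2r.
by rewrite mulr_ge0// subr_ge0// lerXn2r.
Qed.

(** [xget] returns its default 0 only if there is no solution; the intermediate value theorem
    provides one between some - b and -1. *)
Lemma lambertWm1P (R : realType) (y : R) : - expR (-1) <= y < 0 ->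
  lambertWm1 y <= -1 /\ lambertWm1 y * expR (lambertWm1 y) = y.
Proof.
move=> /andP[y1 y0]; rewrite /lambertWm1; set A := (X in xget 0 X).
suff : A !=set0 by move=> [t At]; exact: (xgetPex 0 (ex_intro _ t At)).
(* From e^b >= b^2 / 2, the value at - b is at least - 2 / b > y. *)
pose b := 2 / (- y) + 1.
have b0 : 0 < 2 / (- y) by rewrite divr_gt0// oppr_gt0.
have [| | |v] := @IVT R (fun t => t * expR t) (- b) (-1) y.
- by rewrite lerN2 /b lerDr ltW.
- apply: continuous_subspaceT => t; apply: cvgM; first exact: cvg_id.
  exact: continuous_expR.
- rewrite ge_min le_max mulN1r y1 orbT/=.
  suff -> : y <= - b * expR (- b) by [].
  have b1 : 0 < b by rewrite /b; lra.
  have be : b ^+ 2 / 2 <= expR b.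
    by have := expR_ge1Dxn 1 (ltW b1); rewrite (_ : 2`! = 2)%N//; lra.
  have yb : 2 <= - y * b.
    by rewrite /b mulrDr mulrCA mulfV ?mulr1 ?gt_eqF ?oppr_gt0//; lra.
  rewrite mulNr lerNr expRN ler_pdivrMr ?expR_gt0//.
  have y0' : 0 <= - y by rewrite oppr_ge0 ltW.
  apply: le_trans (ler_wpM2l y0' be); rewrite expr2.
  by have := ler_wpM2r (ltW b1) yb; lra.
by rewrite in_itv/= => /andP[_ v1] vy; exists v.
Qed.

(** * Gaussian moments and tails *)

Section gaussian_estimates.
Variables (R : realType) (d : nat) (P : probability (d.-tuple R) R).
Hypothesis hP : std_gaussian P.

Lemma measurable_enorm_exp (n : nat) :
  measurable_fun setT (fun t : d.-tuple R => enorm (rv t) ^+ n).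
Proof. by apply: measurable_funX; exact: measurable_enorm_rv. Qed.

Lemma integrable_enorm_exp (m : nat) :
  P.-integrable setT (EFin \o (fun t => enorm (rv t) ^+ m)).
Proof.
apply: (@integrable_le_exp _ _ _ hP _ 1 m%:R); first exact: measurable_enorm_exp.
move=> t; rewrite mul1r ger0_norm ?exprn_ge0 ?enorm_ge0//.
by rewrite expn_le_expR ?enorm_ge0.
Qed.

Lemma Rintegral_expR_sqr (l : R) : l < 2^-1 ->
  P.-integrable setT (EFin \o (fun t => expR (l * enorm (rv t) ^+ 2))) /\
  (\int[P]_t expR (l * enorm (rv t) ^+ 2))%R = (Num.sqrt (1 - 2 * l))^-1 ^+ d.
Proof.
move=> l2; have E := gaussian_mgf_sqr hP l2.
have m1 : measurable_fun setT (fun t : d.-tuple R => expR (l * enorm (rv t) ^+ 2)).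
  by apply: measurableT_comp => //; apply: measurable_funM => //; exact: measurable_enorm_exp.
split; last by rewrite /Rintegral E.
apply/integrableP; split; first exact/measurable_EFinP.
under eq_integral do rewrite /= (ger0_norm (expR_ge0 _)).
by rewrite E ltry.
Qed.

(** With n = m + d and y = |u| / sqrt n, raise y <= exp((y^2 - 1)/2) to the power m. The exponential
    moment at l = m/(2 n) has 1 - 2 l = d/n, so the mean is at most n^(m/2) exp(- m/2) (1 +
    m/d)^(d/2), and (1 + m/d)^(d/2) <= exp(m/2). *)
Lemma gaussian_moment_le (m : nat) : (0 < d)%N ->
  (\int[P]_t enorm (rv t) ^+ m)%R <= (m + d)%:R `^ (m%:R / 2).
Proof.
move=> d0; set n : R := (m + d)%:R.
have dR : 0 < d%:R :> R by rewrite ltr0n.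
have n0 : 0 < n by rewrite ltr0n addn_gt0 d0 orbT.
pose l : R := m%:R / (2 * n).
have nE : n = m%:R + d%:R by rewrite /n natrD.
have l2 : l < 2^-1.
  by rewrite ltr_pdivrMr ?mulr_gt0// mulKf ?pnatr_eq0// nE ltrDl.
have lE : 1 - 2 * l = d%:R / n by rewrite /l; field; rewrite nE in n0 *; lra.
have [i1 i2] := Rintegral_expR_sqr l2.
have -> : n `^ (m%:R / 2) = Num.sqrt n ^+ m.
  by rewrite mulrC powRrM powR12_sqrt ?(ltW n0)// powR_mulrn ?sqrtr_ge0.
have sn : 0 < Num.sqrt n by rewrite sqrtr_gt0.
have yle (y : R) : 0 <= y -> y <= expR ((y ^+ 2 - 1) / 2).
  move=> y0; rewrite -(@ler_pXn2r _ 2)// ?nnegrE ?expR_ge0//.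
  by rewrite -expRM_natr divfK ?pnatr_eq0// (le_trans _ (expR_ge1Dx _))// addrC subrK.
have b (t : d.-tuple R) : enorm (rv t) ^+ m <=
    Num.sqrt n ^+ m * expR (- (m%:R / 2)) * expR (l * enorm (rv t) ^+ 2).
  have -> : enorm (rv t) ^+ m = Num.sqrt n ^+ m * (enorm (rv t) / Num.sqrt n) ^+ m.
    by rewrite -exprMn mulrC divfK ?gt_eqF.
  rewrite -mulrA ler_wpM2l ?exprn_ge0 ?(ltW sn)// -expRD.
  have y0 : 0 <= enorm (rv t) / Num.sqrt n by rewrite divr_ge0 ?enorm_ge0 ?(ltW sn).
  have := lerXn2r m y0 (expR_ge0 _) (yle _ y0).
  rewrite -expRM_natr; congr (_ <= expR _).
  rewrite expr_div_n (sqr_sqrtr (ltW n0)) /l; field; rewrite nE in n0 *; lra.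
have := le_Rintegral measurableT (integrable_enorm_exp m)
  (integrableZl measurableT (Num.sqrt n ^+ m * expR (- (m%:R / 2))) i1) (fun t _ => b t).
move=> /le_trans; apply.
rewrite RintegralZl// i2 lE -mulrA ler_piMr ?exprn_ge0 ?(ltW sn)//.
rewrite expRN -ler_pdivlMl ?invr_gt0 ?expR_gt0// invrK mulr1.
have -> : m%:R / 2 = (m%:R / d%:R / 2) * d%:R :> R.
  by field; rewrite gt_eqF.
rewrite expRM_natr lerXn2r ?nnegrE ?invr_ge0 ?sqrtr_ge0 ?expR_ge0//.
rewrite -(@ler_pXn2r _ 2)// ?nnegrE ?invr_ge0 ?sqrtr_ge0 ?expR_ge0//.
rewrite -expRM_natr divfK ?pnatr_eq0// exprVn sqr_sqrtr ?divr_ge0 ?(ltW n0)//.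
rewrite invf_div (le_trans _ (expR_ge1Dx _))// nE mulrDl addrC mulfV ?gt_eqF//.
Qed.

(* Chernoff bound, with exponent l such that 1 - 2 l = 1 / s. *)
Lemma gaussian_tail_le (s : R) : 1 <= s ->
  fine (P [set t | Num.sqrt (d%:R * s) < enorm (rv t)]) <= Num.sqrt (s * expR (1 - s)) ^+ d.
Proof.
move=> s1; set H := Num.sqrt _; set A := [set t | _].
have s0 : 0 < s by lra.
pose l := (1 - s^-1) / 2.
have si : 0 < s^-1 by rewrite invr_gt0.
have si1 : s^-1 <= 1 by rewrite invf_le1.
have l2 : l < 2^-1 by rewrite /l; lra.
have l0 : 0 <= l by rewrite /l; lra.
have lE : 1 - 2 * l = s^-1 by rewrite /l; lra.
have mA : measurable A.
  rewrite (_ : A = (fun t => enorm (rv t)) @^-1` `]H, +oo[); last first.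
    by apply/seteqP; split=> t /=; rewrite in_itv/= andbT.
  by rewrite -[X in measurable X]setTI; exact: measurable_enorm_rv.
have [i1 i2] := Rintegral_expR_sqr l2.
have -> : fine (P A) = (\int[P]_t (\1_A t : R))%R.
  by rewrite /Rintegral integral_indic// setIT.
have b t : \1_A t <= expR (- l * H ^+ 2) * expR (l * enorm (rv t) ^+ 2).
  have [At|At] := pselect (A t); last by rewrite indicE memNset// mulr_ge0 ?expR_ge0.
  rewrite indicE mem_set//= -expRD -expR0 ler_expR mulNr addrC subr_ge0 ler_wpM2l//.
  by rewrite lerXn2r ?nnegrE ?enorm_ge0 ?sqrtr_ge0// ltW.
have iA : P.-integrable setT (EFin \o (\1_A : d.-tuple R -> R)) by exact: integrable_indic.
have := le_Rintegral measurableT iA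
  (integrableZl measurableT (expR (- l * H ^+ 2)) i1) (fun t _ => b t).
move=> /le_trans; apply.
rewrite RintegralZl// i2 lE sqr_sqrtr ?mulr_ge0 ?(ltW s0)//.
have -> : - l * (d%:R * s) = (1 - s) / 2 * d%:R by rewrite /l; field; rewrite gt_eqF.
rewrite expRM_natr -exprMn lerXn2r ?nnegrE ?mulr_ge0 ?invr_ge0 ?sqrtr_ge0 ?expR_ge0//.
rewrite -(@ler_pXn2r _ 2)// ?nnegrE ?mulr_ge0 ?invr_ge0 ?sqrtr_ge0 ?expR_ge0//.
rewrite exprMn exprVn !sqr_sqrtr ?mulr_ge0 ?invr_ge0 ?expR_ge0 ?(ltW s0)// invrK.
by rewrite -expRM_natr divfK ?pnatr_eq0// mulrC.
Qed.

End gaussian_estimates.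

(** * The constants eta_1, H and sigma_bar *)

Section constants.
Variables (R : realType) (d : nat) (R1 R2 eps : R) (m : nat).
Hypotheses (hd : (0 < d)%N) (R10 : 0 <= R1) (R20 : 0 < R2) (eps0 : 0 < eps).
Local Notation M := ((m + d)%:R `^ (m%:R / 2) : R).
Local Notation Pc := (Pconst d R1 R2 m).
Local Notation eta := (eta1 d R1 R2 m eps).
Local Notation G := ((2 * pi) `^ (d%:R / 2) : R).

Let M1 : 1 <= M.
Proof.
rewrite -[leLHS](powRr0 (m + d)%:R); apply: ler_powR; last by rewrite divr_ge0.
by rewrite ler1n addn_gt0 hd orbT.
Qed.

(** From (m + d)^(m/2) >= 1; the left side collects the coefficients that multiply the tail
    probability in the final estimate. *)
Lemma Pconst_ge : 4 * R2 + 2 * (R1 * 2 ^+ m) <= Pc.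
Proof.
rewrite /Pconst lerD2l exprS.
have : 0 <= R1 * 2 ^+ m by rewrite mulr_ge0// exprn_ge0.
move=> /ler_wpM2l/(_ _ _ M1); lra.
Qed.

Lemma Pconst_gt0 : 0 < Pc.
Proof.
apply: lt_le_trans Pconst_ge.
have : 0 <= R1 * 2 ^+ m by rewrite mulr_ge0// exprn_ge0.
by have := R20; lra.
Qed.

Let pi2 : 4 <= 2 * pi :> R.
Proof. by have := pi_ge2 R; lra. Qed.

(** Gains a factor 2 in the tail bound and keeps the cap G - 1/2 in [eta1] positive. *)
Lemma gaussian_const_ge2 : 2 <= G.
Proof.
have E : 2 = 4 `^ 2^-1 :> R.
  by rewrite powR12_sqrt// (_ : 4 = 2 ^+ 2) ?sqrtr_sqr ?ger0_norm// -natrX.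
rewrite [leLHS]E; apply: (@le_trans _ _ ((2 * pi) `^ 2^-1)).
  by apply: ge0_ler_powR; rewrite ?nnegrE// (le_trans _ pi2).
apply: ler_powR; first by apply: le_trans pi2; rewrite ler1n.
by rewrite ler_peMl ?invr_ge0// ler1n.
Qed.

Lemma eta1_gt0 : 0 < eta.
Proof.
rewrite /eta1 lt_min divr_gt0 ?Pconst_gt0//=.
by have := gaussian_const_ge2; lra.
Qed.

(** The purpose of the cap in [eta1]: it places the argument of W_{-1} in [-1/e, 0), and it makes
    the tail probability less than 1, so that the ball of radius H has positive mass. *)
Lemma eta1_lt : eta < G.
Proof. by rewrite gt_min orbC; have -> : G - 2^-1 < G by lra. Qed.

Lemma eta1_Pconst_le : eta * Pc <= eps.
Proof. by rewrite -ler_pdivlMr ?Pconst_gt0// ge_min lexx. Qed.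

(* s is - W_{-1}(- eta_1^(2/d) / (2 pi e)). *)
Lemma Hconst_spec : exists2 s, 1 <= s &
  Hconst d R1 R2 m eps = Num.sqrt (d%:R * s) /\ Num.sqrt (s * expR (1 - s)) ^+ d = eta / G.
Proof.
rewrite /Hconst; set y := (X in lambertWm1 X).
have pi0 : 0 < 2 * pi :> R by apply: lt_le_trans pi2.
have dR : 0 < d%:R :> R by rewrite ltr0n.
have e0 : 0 < eta `^ (2 / d%:R) by rewrite powR_gt0// eta1_gt0.
have e1 : eta `^ (2 / d%:R) <= 2 * pi.
  have -> : 2 * pi = G `^ (2 / d%:R).
    rewrite -powRrM (_ : d%:R / 2 * (2 / d%:R) = 1) ?powRr1 ?(ltW pi0)//.
    by field; rewrite gt_eqF.
  rewrite ge0_ler_powR ?divr_ge0// ?nnegrE ?powR_ge0 ?(ltW eta1_gt0)//.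
  exact: ltW eta1_lt.
have yE : y = - (eta `^ (2 / d%:R) / (2 * pi) * expR (-1)).
  by rewrite /y expRN mulNr invfM mulrA.
have [] := @lambertWm1P R y.
  rewrite yE lerN2 oppr_lt0 mulr_gt0 ?divr_gt0 ?expR_gt0// andbT.
  by rewrite ler_piMl ?expR_ge0// ler_pdivrMr// mul1r.
move: (lambertWm1 y) => W W1 WE; exists (- W); first by rewrite lerNr.
split; first by rewrite mulrN.
(* This is W e^W = y multiplied by - e; its power d/2 is eta_1 / (2 pi)^(d/2). *)
have -> : - W * expR (1 - - W) = eta `^ (2 / d%:R) / (2 * pi).
  by rewrite opprK addrC expRD mulrA mulNr WE yE opprK expRN divfK// gt_eqF ?expR_gt0.
have q0 : 0 <= eta `^ (2 / d%:R) / (2 * pi) by rewrite divr_ge0 ?(ltW e0) ?(ltW pi0).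
rewrite -powR_mulrn ?sqrtr_ge0// -powR12_sqrt// -powRrM [2^-1 * _]mulrC.
rewrite [LHS]powRM ?invr_ge0 ?(ltW pi0) ?(ltW e0)//.
rewrite -powRrM (_ : 2 / d%:R * (d%:R / 2) = 1) ?powRr1 ?(ltW eta1_gt0)//; last first.
  by field; rewrite gt_eqF.
congr (_ * _).
by rewrite -powR_inv1 ?(ltW pi0)// -powRrM mulN1r powRN.
Qed.

Lemma sigma_bar_Hconst_le (delta sigma : R) : 0 < delta ->
  sigma <= sigma_bar d R1 R2 m eps delta -> sigma * Hconst d R1 R2 m eps <= delta.
Proof.
move=> delta0 h; have [s s1 [HE _]] := Hconst_spec.
have H0 : 0 < Hconst d R1 R2 m eps.
  by rewrite HE sqrtr_gt0 mulr_gt0 ?ltr0n// (lt_le_trans ltr01).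
rewrite -ler_pdivlMr//; move: h; rewrite /sigma_bar; case: ifP => _.
  by rewrite le_min => /andP[].
by rewrite !le_min => /and3P[].
Qed.

Lemma sigma_bar_pow_le (delta sigma : R) : (m = 0%N -> R1 = 0) -> (R1 = 0 -> m = 0%N) ->
  0 <= sigma -> sigma <= sigma_bar d R1 R2 m eps delta ->
  R1 * 2 ^+ m * sigma ^+ m * M <= eps / 2.
Proof.
(* When m = 0 the first term of the minimum is absent, and R1 = 0 makes the left side vanish. *)
move=> mR1 R1m s0; rewrite /sigma_bar; case: ifPn => [/eqP/mR1 ->|m0].
  by rewrite !mul0r divr_ge0 ?(ltW eps0).
have R1p : 0 < R1.
  by rewrite lt_def R10 andbT; apply: contraNN m0 => /eqP/R1m ->.
rewrite le_min => /andP[+ _].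
have K0 : 0 < 2 ^+ m.+1 * R1 * M.
  by rewrite !mulr_gt0 ?exprn_gt0// (lt_le_trans ltr01).
move=> h; have : sigma ^+ m <= eps / (2 ^+ m.+1 * R1 * M).
  rewrite (le_trans (lerXn2r m _ _ h))// ?nnegrE ?powR_ge0//.
  by rewrite -[leLHS]powR_mulrn ?powR_ge0// -powRrM mulVf ?pnatr_eq0// powRr1// divr_ge0 ?(ltW eps0) ?(ltW K0).
rewrite ler_pdivlMr// exprS; lra.
Qed.

End constants.

Section goldstein_approximation.
Variables (R : realType) (d : nat) (P : probability (d.-tuple R) R).
Hypothesis hP : std_gaussian P.
Hypothesis hd : (0 < d)%N.
Variables (f : 'rV[R]_d -> R) (R1 R2 : R) (m : nat).
Hypothesis hf : SPB f R1 R2 m.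
Variables (sigma : R) (x : 'rV[R]_d).
Hypothesis s0 : 0 < sigma.

Let R10 : 0 <= R1. Proof. by have [] := hf. Qed.
Let R20 : 0 < R2. Proof. by have [_ []] := hf. Qed.
Local Notation V := (gradD f sigma x).
Local Notation D := (diff_set f sigma x).

(** a + b |u|^m bounds the gradient at x + sigma u, through |x + sigma u|^m <= 2^m / 2 (|x|^m +
    sigma^m |u|^m). *)
Let a := R1 * 2 ^+ m / 2 * enorm x ^+ m + R2.
Let b := R1 * 2 ^+ m / 2 * sigma ^+ m.

Let b0 : 0 <= b.
Proof. by rewrite /b !mulr_ge0 ?invr_ge0 ?exprn_ge0 ?(ltW s0). Qed.

Let a0 : 0 <= a.
Proof. by rewrite /a addr_ge0 ?(ltW R20)// !mulr_ge0 ?invr_ge0 ?exprn_ge0 ?enorm_ge0. Qed.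

Lemma gradD_le_poly t : enorm (V t) <= a + b * enorm (rv t) ^+ m.
Proof.
apply: le_trans (gradD_le hf sigma x t) _.
have u0 : 0 <= sigma * enorm (rv t) by rewrite mulr_ge0 ?enorm_ge0 ?(ltW s0).
have := exprD_le m (enorm_ge0 x) u0; rewrite exprMn => /(ler_wpM2l R10).
have := lerXn2r m (enorm_ge0 _) (addr_ge0 (enorm_ge0 x) u0) (enorm_affine_le s0 x (rv t)).
move=> /(ler_wpM2l R10); rewrite /a /b; lra.
Qed.

(** Off the ball S, |g| <= a + b H^m <= a + b |u|^m, so V - g is at most 2 a + 2 b |u|^m. The
    constant part is paid by the tail probability q; the other part by a full moment, since b is
    small with sigma. *)
Lemma smoothing_grad_approx (H delta e : R) : 0 <= H -> sigma * H <= delta -> 0 < e ->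
  let q := fine (P [set t | H < enorm (rv t)]) in q < 1 ->
  exists2 g, goldstein f delta x g & enorm (grad (smoothing P f sigma) x - g) <=
    e + 2 * a * q + 2 * b * (\int[P]_t enorm (rv t) ^+ m)%R.
Proof.
move=> H0 sH e0 q q1.
pose S := [set t : d.-tuple R | enorm (rv t) <= H].
have SC : [set t : d.-tuple R | H < enorm (rv t)] = ~` S.
  by apply/seteqP; split=> t /=; rewrite ltNge => /negP.
have mS : measurable S.
  rewrite (_ : S = (fun t => enorm (rv t)) @^-1` `]-oo, H]); last first.
    by apply/seteqP; split=> t /=; rewrite in_itv.
  by rewrite -[X in measurable X]setTI; exact: measurable_enorm_rv.
have mD := measurable_diff_set hf sigma x.
have PD : P (~` D) = 0.
  apply/negligibleP; first exact: measurableC.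
  have := ae_diff_set hP hf x s0; rewrite /almost_everywhere/=; exact.
(* Off D the integrand V is 0, which need not be a Clarke subgradient, so the hull is built over S
   and D together; nothing is lost in measure. *)
have PSD : P (S `&` D) = P S.
  rewrite (measureDI P mS mD).
  rewrite [X in (X + _)%E](_ : _ = 0%E) ?add0e//.
  apply/eqP; rewrite eq_le measure_ge0 andbT -PD le_measure// ?inE//.
  - exact: measurableD.
  - exact: measurableC.
set p := fine (P S).
have PSfin : P S \is a fin_num by exact: fin_num_measure.
have qp : q = 1 - p.
  by rewrite /q SC probability_setC// -(fineK PSfin) -EFinB.
have p0 : 0 < p by lra.
have p1 : p <= 1 by rewrite -lee_fin fineK// probability_le1.
have Vind t i : \1_(S `&` D) t * V t 0 i = \1_S t * V t 0 i.
  have [Dt|Dt] := pselect (D t).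
    by rewrite indicI/= [\1_D t]indicE mem_set// mulr1.
  by rewrite gradD0// mxE !mulr0.
have iV := integrable_gradD hP hf x s0.
have iSV (A : set (d.-tuple R)) i : measurable A ->
    P.-integrable setT (EFin \o (fun t => \1_A t * V t 0 i)).
  move=> mA; apply: le_integrable (iV i) => //.
    apply/measurable_EFinP; apply: measurable_funM; first exact: measurable_indic.
    exact: (measurable_gradD hf).
  move=> t _; rewrite /= lee_fin normrM ler_piMl// indicE.
  by case: (t \in A); rewrite ?normr1 ?normr0.
have VB t : (S `&` D) t -> enorm (V t) <= a + b * H ^+ m.
  move=> [St _]; rewrite (le_trans (gradD_le_poly t))// lerD2l ler_wpM2l//.
  by rewrite lerXn2r ?nnegrE ?enorm_ge0.
have [|g Cg] := conv_mean_approx (measurableI _ _ mS mD)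
  (fun i => iSV _ i (measurableI _ _ mS mD)) VB _ e0; first by rewrite PSD.
rewrite PSD -/p.
have -> : \row_i (\int[P]_t (\1_(S `&` D) t * V t 0 i))%R = \row_i (\int[P]_t (\1_S t * V t 0 i))%R.
  by apply/rowP => i; rewrite !mxE; apply: eq_Rintegral => t _.
move=> gp.
exists g.
  apply: conv_sub Cg => _ [t [St Dt] <-]; exists (x + sigma *: rv t); split.
    rewrite addrAC subrr add0r enormZ gtr0_norm// (le_trans _ sH)//.
    by rewrite ler_wpM2l// (ltW s0).
  by rewrite gradDE//; exact: grad_clarke.
have gB : enorm g <= a + b * H ^+ m.
  by apply: conv_enorm_le Cg => _ [t St <-]; exact: VB.
rewrite (smoothing_grad hP hf x s0).2.
pose U t : 'rV[R]_d := \1_(~` S) t *: (V t - g).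
have iS (A : set (d.-tuple R)) : measurable A -> P.-integrable setT (EFin \o (\1_A : _ -> R)).
  by move=> mA; exact: integrable_indic.
have iSc (A : set (d.-tuple R)) (c : R) : measurable A ->
    P.-integrable setT (EFin \o (fun t => \1_A t * c)).
  move=> mA; have := integrableZr measurableT c (iS _ mA).
  by congr (P.-integrable _ _); apply/funext => t /=; rewrite -EFinM.
have IC (A : set (d.-tuple R)) : measurable A -> (\int[P]_t (\1_A t : R))%R = fine (P A).
  by move=> mA; rewrite /Rintegral integral_indic// setIT.
have mSC : measurable (~` S) by exact: measurableC.
have UE i : (fun t => U t 0 i) = (fun t => \1_(~` S) t * V t 0 i - \1_(~` S) t * g 0 i).
  by apply/funext => t; rewrite !mxE mulrBr.
have iU i : P.-integrable setT (EFin \o (fun t => U t 0 i)).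
  by rewrite UE; exact: (integrableB measurableT (iSV _ i mSC) (iSc _ (g 0 i) mSC)).
have qE : fine (P (~` S)) = q by rewrite -SC.
(* As p + q = 1, g splits into p g, compared with the integral over S, and q g, absorbed in the
   integral of V - g over the complement. *)
have -> : \row_i (\int[P]_t V t 0 i)%R - g =
    (\row_i (\int[P]_t (\1_S t * V t 0 i))%R - p *: g) + \row_i (\int[P]_t U t 0 i)%R.
  apply/rowP => i; rewrite !mxE UE.
  rewrite (RintegralB measurableT (iSV _ i mSC) (iSc _ (g 0 i) mSC)).
  rewrite RintegralZr ?IC ?qE//; last exact: iS.
  have -> : (\int[P]_t V t 0 i)%R =
      (\int[P]_t (\1_S t * V t 0 i))%R + (\int[P]_t (\1_(~` S) t * V t 0 i))%R.
    rewrite -(RintegralD measurableT (iSV _ i mS) (iSV _ i mSC)).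
    apply: eq_Rintegral => t _; rewrite -mulrDl !indicE in_setC.
    by case: (t \in S); rewrite ?addr0 ?add0r mul1r.
  rewrite qp; ring.
rewrite (le_trans (enormD _ _))// -addrA lerD//.
  by rewrite (le_trans gp)// ler_piMl// (ltW e0).
pose W (t : d.-tuple R) := \1_(~` S) t * (2 * a) + 2 * b * enorm (rv t) ^+ m.
have iX := integrable_enorm_exp hP m.
have iW : P.-integrable setT (EFin \o W).
  exact: (integrableD measurableT (iSc _ (2 * a) mSC) (integrableZl measurableT (2 * b) iX)).
have -> : 2 * a * q + 2 * b * (\int[P]_t enorm (rv t) ^+ m)%R = (\int[P]_t W t)%R.
  rewrite (RintegralD measurableT (iSc _ (2 * a) mSC) (integrableZl measurableT (2 * b) iX)).
  rewrite RintegralZr ?IC ?qE//; last exact: iS.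
  by rewrite RintegralZl// (mulrC q).
apply: (enorm_Rintegral_le iU iW) => t; rewrite /U /W enormZ.
have X0 : 0 <= enorm (rv t) ^+ m by rewrite exprn_ge0 ?enorm_ge0.
have bX0 : 0 <= b * enorm (rv t) ^+ m by rewrite mulr_ge0.
have [St|St] := pselect (S t).
  by rewrite indicE in_setC (mem_set St) normr0 !mul0r add0r -mulrA mulr_ge0.
rewrite indicE mem_set// normr1 !mul1r (le_trans (enormD _ _))// enormN.
have HX : b * H ^+ m <= b * enorm (rv t) ^+ m.
  rewrite ler_wpM2l// lerXn2r ?nnegrE ?enorm_ge0// ltW// ltNge.
  exact/negP.
by have := gradD_le_poly t; lra.
Qed.

Lemma smoothing_grad_goldstein (delta eps : R) : 0 < delta -> 0 < eps ->
  sigma <= sigma_bar d R1 R2 m eps delta ->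
  exists g, goldstein f delta x g /\
    enorm (grad (smoothing P f sigma) x - g) <= (1 + enorm x ^+ m) * eps.
Proof.
move=> delta0 eps0 ss.
have [_ [_ [[R1m mR1] _]]] := hf.
have [s s1 [HE sE]] := Hconst_spec m hd R10 R20 eps0.
set H := Hconst d R1 R2 m eps in HE.
set q := fine (P [set t | H < enorm (rv t)]).
have G2 := gaussian_const_ge2 R hd.
have et0 := eta1_gt0 m hd R10 R20 eps0.
have qle : q <= eta1 d R1 R2 m eps / (2 * pi) `^ (d%:R / 2).
  by rewrite -sE /q HE; exact: gaussian_tail_le.
have G0 : 0 < (2 * pi) `^ (d%:R / 2) :> R by lra.
have q1 : q < 1.
  by rewrite (le_lt_trans qle)// ltr_pdivrMr// mul1r eta1_lt.
have q2 : 2 * q <= eta1 d R1 R2 m eps.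
  move: qle; rewrite ler_pdivlMr//; apply: le_trans.
  by rewrite mulrC ler_wpM2l// /q fine_ge0.
have q0 : 0 <= q by rewrite /q fine_ge0.
(* Budget: eps/4 for the hull approximation, 2 q R2 <= eps/4, and eps/2 for the moment term by the
   first entry of [sigma_bar]. The tail term in |x|^m needs only q R1 2^m <= eps/4. *)
have [|||g gG gle] := @smoothing_grad_approx H delta (eps / 4) _ _ _ q1.
- by rewrite HE sqrtr_ge0.
- exact: sigma_bar_Hconst_le.
- by rewrite divr_gt0.
exists g; split=> //; apply: le_trans gle _.
have qP : 2 * q * Pconst d R1 R2 m <= eps.
  apply: le_trans (eta1_Pconst_le eps m hd R10 R20).
  by rewrite ler_wpM2r// ltW// Pconst_gt0.
have K0 : 0 <= R1 * 2 ^+ m by rewrite mulr_ge0// exprn_ge0.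
have Pge := Pconst_ge R2 m hd R10.
have q20 : 0 <= 2 * q by rewrite mulr_ge0.
have qK : 2 * q * (4 * R2 + 2 * (R1 * 2 ^+ m)) <= eps.
  by apply: le_trans qP; exact: ler_wpM2l.
have X0 : 0 <= enorm x ^+ m by rewrite exprn_ge0 ?enorm_ge0.
have qR : 0 <= q * R2 by rewrite mulr_ge0// (ltW R20).
have qK0 : 0 <= q * (R1 * 2 ^+ m) by rewrite mulr_ge0.
have h1 : 4 * (q * (R1 * 2 ^+ m)) * enorm x ^+ m <= eps * enorm x ^+ m.
  by rewrite ler_wpM2r//; lra.
have h2 : 2 * b * (\int[P]_t enorm (rv t) ^+ m)%R <= eps / 2.
  apply: le_trans (sigma_bar_pow_le hd R10 eps0 mR1 R1m (ltW s0) ss).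
  have -> : R1 * 2 ^+ m * sigma ^+ m * (m + d)%:R `^ (m%:R / 2) = 2 * b * (m + d)%:R `^ (m%:R / 2).
    by rewrite /b; field.
  have b20 : 0 <= 2 * b := mulr_ge0 (ler0n _ _) b0.
  exact: ler_wpM2l b20 _ _ (gaussian_moment_le hP m hd).
have eX : 0 <= eps * enorm x ^+ m by rewrite mulr_ge0// ltW.
by rewrite -/q /a; lra.
Qed.

End goldstein_approximation.

Theorem theorem3p7 (R : realType) (d : nat) (hd : (0 < d)%N)
  (P : probability (d.-tuple R) R) (hP : std_gaussian P)
  (f : 'rV[R]_d -> R) (R1 R2 : R) (m : nat) (hf : SPB f R1 R2 m) :
  (forall (sigma : R) (x : 'rV[R]_d), 0 < sigma ->
     differentiable (smoothing P f sigma) x /\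
     grad (smoothing P f sigma) x =
       \row_(i < d) Rintegral P setT (fun t =>
          grad f (x + sigma *: rv t) 0 i *
          \1_[set u : 'rV[R]_d | differentiable f (x + sigma *: u)] (rv t))) /\
  (forall delta eps : R, 0 < delta -> 0 < eps ->
     forall (sigma : R) (x : 'rV[R]_d), 0 < sigma -> sigma <= sigma_bar d R1 R2 m eps delta ->
       exists g : 'rV[R]_d, goldstein f delta x g /\
         enorm (grad (smoothing P f sigma) x - g) <= (1 + enorm x ^+ m) * eps).
Proof.
split=> [sigma x s0|delta eps delta0 eps0 sigma x s0]; last exact: smoothing_grad_goldstein.
have [dS ->] := smoothing_grad hP hf x s0; split=> //.
apply/rowP => i; rewrite !mxE; apply: eq_Rintegral => t _.
have [Dt|Dt] := pselect (diff_set f sigma x t).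
  by rewrite gradDE// indicE mem_set// mulr1.
by rewrite gradD0// indicE memNset// mulr0 mxE.
Qed.
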